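(* Let $\mathfrak{A}$ be a complex unital algebra with two normalized linear functionals $\varphi,\psi:\mathfrak{A}\to\mathbb{C}$, and let $X,Y\in\mathfrak{A}$ be c-free in $(\mathfrak{A},\varphi,\psi)$ with $\psi(X)\neq 0\neq\psi(Y)$. Then, as formal power series, \[ \left(\tfrac1z\,{}^cR_{XY}\right)\circ R_{XY}^{\langle -1\rangle}(z)=\left[\left(\tfrac1z\,{}^cR_{X}\right)\circ R_{X}^{\langle -1\rangle}(z)\right]\cdot\left[\left(\tfrac1z\,{}^cR_{Y}\right)\circ R_{Y}^{\langle -1\rangle}(z)\right]. \]
   Context: Normalized means $\varphi(1)=\psi(1)=1$. Elements $X,Y\in\mathfrak{A}$ are c-free (conditionally free) in $(\mathfrak{A},\varphi,\psi)$ if the unital subalgebras $\mathfrak{A}_1,\mathfrak{A}_2$ generated by $X$, respectively $Y$, satisfy: whenever $a_j\in\mathfrak{A}_{\varepsilon(j)}$ with $\varepsilon(j)\in\{1,2\}$, $\varepsilon(1)\neq\varepsilon(2)\neq\dots\neq\varepsilon(n)$ (consecutive indices differ) and $\psi(a_j)=0$ for all $1\le j\le n$, one has $\psi(a_1\cdots a_n)=0$ and $\varphi(a_1\cdots a_n)=\varphi(a_1)\cdots\varphi(a_n)$. $NC(n)$ is the set of non-crossing partitions of $\{1,\dots,n\}$. A block $B$ of $\gamma\in NC(n)$ is interior if there are another block $D$ of $\gamma$ and $i,j\in D$ with $i<b<j$ for all $b\in B$; otherwise it is exterior. $Int(\gamma)$, $Ext(\gamma)$ are the sets of interior, exterior blocks.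 The free cumulants $R^n$ and c-free cumulants ${}^cR^n$ are the multilinear maps $\mathfrak{A}^n\to\mathbb{C}$ determined recursively by requiring, for all $n\ge1$ and $a_1,\dots,a_n\in\mathfrak{A}$ (blocks are written in increasing order $i_1<\dots<i_k$), \[ \psi(a_1\cdots a_n)=\sum_{\gamma\in NC(n)}\ \prod_{B=(i_1,\dots,i_k)\in\gamma}R^k(a_{i_1},\dots,a_{i_k}), \] \[ \varphi(a_1\cdots a_n)=\sum_{\gamma\in NC(n)}\ \prod_{D=(i_1,\dots,i_k)\in Ext(\gamma)}{}^cR^k(a_{i_1},\dots,a_{i_k})\prod_{B=(j_1,\dots,j_s)\in Int(\gamma)}R^s(a_{j_1},\dots,a_{j_s}). \] For $W\in\mathfrak{A}$, $R_W(z)=\sum_{n\ge1}R^n(W,\dots,W)z^n$ and ${}^cR_W(z)=\sum_{n\ge1}{}^cR^n(W,\dots,W)z^n$. $F^{\langle-1\rangle}$ is the inverse under composition of a formal power series $F$ with zero constant term and nonzero linear coefficient, and $\left(\frac1zF\right)\circ G$ denotes the power series $F(z)/z$ composed with $G$. *)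

(* Defs.v *)
From HB Require Import structures.
From mathcomp Require Import all_boot all_order all_algebra.
From mathcomp Require Import boolp.
From mathcomp Require classical_sets.

Set Implicit Arguments.
Unset Strict Implicit.
Unset Printing Implicit Defensive.

Import GRing.Theory.
Local Open Scope ring_scope.

Section NonCrossing.
Variable n : nat.
Implicit Types (g : {set {set 'I_n}}) (B D : {set 'I_n}).

Definition crossing B D : bool :=
  [exists i in B, exists j in D, exists k in B, exists l in D,
    [&& (i < j)%N, (j < k)%N & (k < l)%N]].

Definition noncrossing g : bool :=
  [forall B in g, forall D in g, (B != D) ==> ~~ crossing B D].

Definition NC : {set {set {set 'I_n}}} :=
  [set g | partition g [set: 'I_n] && noncrossing g].

Definition interior_block g B : bool :=
  [exists D in g, (D != B) &&
    [exists i in D, exists j in D, forall b in B, (i < b < j)%N]].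

End NonCrossing.
Arguments NC : clear implicits.

Section CFree.
Variables (K : fieldType) (A : algType K).
Implicit Types (X Y a : A) (phi psi : {scalar A}).

(* With the classical axioms of boolp, {pred A} ranges over all subsets of A. *)
Definition gen_subalg X : A -> Prop :=
  fun a => forall S : {pred A}, GRing.subalg_closed S -> X \in S -> a \in S.

(* The factors of [\prod_i a i] are taken in increasing order of [i];
   [e i] tells which of the two subalgebras [a i] comes from. *)
Definition cfree phi psi X Y : Prop :=
  forall (n : nat) (e : 'I_n.+1 -> bool) (a : 'I_n.+1 -> A),
    (forall i, gen_subalg (if e i then Y else X) (a i)) ->
    (forall i j : 'I_n.+1, j = i.+1 :> nat -> e i != e j) ->
    (forall i, psi (a i) = 0) ->
    psi (\prod_i a i) = 0 /\ phi (\prod_i a i) = \prod_i phi (a i).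

(* A family of maps [A ^ k -> K], k >= 1, is encoded as one map [seq A -> K];
   its value at [::] is irrelevant.  Since [enum B] is increasing,
   [[seq a i | i in B]] is (a_(i_1), ..., a_(i_k)) for B = {i_1 < ... < i_k}. *)
Definition free_moment_cumulant psi (R : seq A -> K) : Prop :=
  forall (n : nat) (a : 'I_n.+1 -> A),
    psi (\prod_i a i) =
    \sum_(g in NC n.+1) \prod_(B in g) R [seq a i | i in B].

Definition cfree_moment_cumulant phi (R cR : seq A -> K) : Prop :=
  forall (n : nat) (a : 'I_n.+1 -> A),
    phi (\prod_i a i) =
    \sum_(g in NC n.+1)
      ((\prod_(D in g | ~~ interior_block g D) cR [seq a i | i in D]) *
       (\prod_(B in g | interior_block g B) R [seq a i | i in B])).

(* The moment-cumulant formulas solved for the term of the one-block partition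
   [[set setT]]; [m] bounds the depth of the recursion.  See [free_cumulantP],
   [cfree_cumulantP] and the uniqueness lemmas that follow them. *)
Fixpoint free_cumulant_rec psi (m : nat) (s : seq A) : K :=
  if m is m'.+1 then
    psi (\prod_(x <- s) x) -
    \sum_(g in NC (size s) | g != [set setT])
      \prod_(B in g) free_cumulant_rec psi m' [seq s`_i | i : 'I_(size s) in B]
  else 0.

Definition free_cumulant psi (s : seq A) : K :=
  free_cumulant_rec psi (size s) s.

Fixpoint cfree_cumulant_rec phi psi (m : nat) (s : seq A) : K :=
  if m is m'.+1 then
    phi (\prod_(x <- s) x) -
    \sum_(g in NC (size s) | g != [set setT])
      ((\prod_(D in g | ~~ interior_block g D)
          cfree_cumulant_rec phi psi m' [seq s`_i | i : 'I_(size s) in D]) *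
       (\prod_(B in g | interior_block g B)
          free_cumulant psi [seq s`_i | i : 'I_(size s) in B]))
  else 0.

Definition cfree_cumulant phi psi (s : seq A) : K :=
  cfree_cumulant_rec phi psi (size s) s.

End CFree.

Lemma NC_setT n : [set [set: 'I_n.+1]] \in NC n.+1.
Proof.
rewrite inE; apply/andP; split.
  rewrite /partition trivIset1 /cover big_set1 eqxx /= inE eq_sym.
  by apply/set0Pn; exists ord0; rewrite inE.
apply/forall_inP => B /set1P->; apply/forall_inP => D /set1P->.
by rewrite eqxx.
Qed.

Lemma NC_block_size n (g : {set {set 'I_n}}) (B : {set 'I_n}) :
  g \in NC n -> g != [set setT] -> B \in g -> (0 < #|B| < n)%N.
Proof.
rewrite inE => /andP[/and3P[/eqP cg /trivIsetP tg g0] _] gT Bg.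
apply/andP; split; first by rewrite card_gt0; apply: contraNneq g0 => <-.
rewrite ltnNge; apply: contra gT => nB.
have BT : B = setT.
  by apply/eqP; rewrite eqEcard subsetT cardsT card_ord.
rewrite BT in Bg *; apply/eqP/setP => D; rewrite inE.
apply/idP/eqP => [Dg|->//]; apply/eqP/negPn/negP => DT.
have := tg _ _ Dg Bg DT; rewrite -setI_eq0 setIT => /eqP D0.
by rewrite -D0 Dg in g0.
Qed.

Lemma interior_block_set1 n (B : {set 'I_n}) :
  interior_block [set B] B = false.
Proof.
by apply/negbTE/negP => /exists_inP[D /set1P-> /andP[/eqP]].
Qed.

Section CumulantFormulas.
Variables (K : fieldType) (A : algType K) (phi psi : {scalar A}).

Lemma image_setT (s : seq A) : [seq s`_i | i : 'I_(size s) in setT] = s.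
Proof.
rewrite /image_mem (eq_enum (B := 'I_(size s))); last by move=> i; rewrite !inE.
by rewrite (map_comp (nth 0 s) val) val_enum_ord map_nth_iota0 ?take_size.
Qed.

Lemma free_cumulant_recE m s : (0 < size s <= m)%N ->
  free_cumulant_rec psi m s = free_cumulant psi s.
Proof.
elim/ltn_ind: m s => -[|m] IH s /andP[s0 sm]; first by case: (size s) s0 sm.
rewrite /free_cumulant; case E: (size s) => [|k]; first by rewrite E in s0.
rewrite /=; congr (_ - _); apply: eq_bigr => g /andP[gN gT].
apply: eq_bigr => B /(NC_block_size gN gT)/andP[B0 Bs].
have Bk : (0 < size [seq (s`_i)%R | i : 'I_(size s) in B] <= k)%N.
  by rewrite size_image B0 -ltnS -E.
have km : (k <= m)%N by rewrite -ltnS -E.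
have [B0' Bk'] := andP Bk.
rewrite IH //; last by rewrite B0' (leq_trans Bk').
by rewrite [RHS]IH.
Qed.

Lemma cfree_cumulant_recE m s : (0 < size s <= m)%N ->
  cfree_cumulant_rec phi psi m s = cfree_cumulant phi psi s.
Proof.
elim/ltn_ind: m s => -[|m] IH s /andP[s0 sm]; first by case: (size s) s0 sm.
rewrite /cfree_cumulant; case E: (size s) => [|k]; first by rewrite E in s0.
rewrite /=; congr (_ - _); apply: eq_bigr => g /andP[gN gT].
congr (_ * _); apply: eq_bigr => B /andP[/(NC_block_size gN gT)/andP[B0 Bs] _].
have Bk : (0 < size [seq (s`_i)%R | i : 'I_(size s) in B] <= k)%N.
  by rewrite size_image B0 -ltnS -E.
have km : (k <= m)%N by rewrite -ltnS -E.
have [B0' Bk'] := andP Bk.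
rewrite IH //; last by rewrite B0' (leq_trans Bk').
by rewrite [RHS]IH.
Qed.

Lemma free_cumulantE s : (0 < size s)%N ->
  free_cumulant psi s = psi (\prod_(x <- s) x) -
    \sum_(g in NC (size s) | g != [set setT])
      \prod_(B in g) free_cumulant psi [seq s`_i | i : 'I_(size s) in B].
Proof.
rewrite {1}/free_cumulant; case E: {1 2}(size s) => [//|k] _ /=.
congr (_ - _); apply: eq_bigr => g /andP[gN gT].
apply: eq_bigr => B /(NC_block_size gN gT)/andP[B0 Bs].
by rewrite free_cumulant_recE // size_image B0 -ltnS -E.
Qed.

Lemma cfree_cumulantE s : (0 < size s)%N ->
  cfree_cumulant phi psi s = phi (\prod_(x <- s) x) -
    \sum_(g in NC (size s) | g != [set setT])
      ((\prod_(D in g | ~~ interior_block g D)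
          cfree_cumulant phi psi [seq s`_i | i : 'I_(size s) in D]) *
       (\prod_(B in g | interior_block g B)
          free_cumulant psi [seq s`_i | i : 'I_(size s) in B])).
Proof.
rewrite {1}/cfree_cumulant; case E: {1 2}(size s) => [//|k] _ /=.
congr (_ - _); apply: eq_bigr => g /andP[gN gT]; congr (_ * _).
apply: eq_bigr => B /andP[/(NC_block_size gN gT)/andP[B0 Bs] _].
by rewrite cfree_cumulant_recE // size_image B0 -ltnS -E.
Qed.

Lemma free_moment_seq n (s : seq A) : size s = n -> (0 < n)%N ->
  psi (\prod_(x <- s) x) =
  \sum_(g in NC n) \prod_(B in g) free_cumulant psi [seq s`_i | i : 'I_n in B].
Proof.
move=> <- s0; have sT : [set setT] \in NC (size s).
  by case: (size s) s0 => // k _; apply: NC_setT.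
by rewrite (bigD1 [set setT]) //= big_set1 image_setT free_cumulantE // subrK.
Qed.

Lemma cfree_moment_seq n (s : seq A) : size s = n -> (0 < n)%N ->
  phi (\prod_(x <- s) x) =
  \sum_(g in NC n)
    ((\prod_(D in g | ~~ interior_block g D)
        cfree_cumulant phi psi [seq s`_i | i : 'I_n in D]) *
     (\prod_(B in g | interior_block g B)
        free_cumulant psi [seq s`_i | i : 'I_n in B])).
Proof.
move=> <- s0; have sT : [set setT] \in NC (size s).
  by case: (size s) s0 => // k _; apply: NC_setT.
rewrite (bigD1 [set setT]) //=.
rewrite !(big_mkcondr _ _ (mem [set setT])) /= !big_set1 interior_block_set1 /=.
by rewrite mulr1 image_setT cfree_cumulantE // subrK.
Qed.

Lemma nth_codom_ord n (a : 'I_n -> A) (B : {set 'I_n}) :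
  [seq (codom a)`_i | i : 'I_n in B] = [seq a i | i in B].
Proof.
apply: eq_map => i; rewrite /codom /image_mem (nth_map i) ?size_enum_ord //.
by rewrite nth_ord_enum.
Qed.

Lemma prod_codom n (a : 'I_n -> A) : \prod_(x <- codom a) x = \prod_i a i.
Proof. by rewrite /codom /image_mem big_map enumT [index_enum _]unlock. Qed.

Lemma free_cumulantP : free_moment_cumulant psi (free_cumulant psi).
Proof.
move=> n a; rewrite -prod_codom.
rewrite (free_moment_seq (n := n.+1)) ?size_codom ?card_ord //.
by apply: eq_bigr => g _; apply: eq_bigr => B _; rewrite nth_codom_ord.
Qed.

Lemma cfree_cumulantP :
  cfree_moment_cumulant phi (free_cumulant psi) (cfree_cumulant phi psi).
Proof.
move=> n a; rewrite -prod_codom.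
rewrite (cfree_moment_seq (n := n.+1)) ?size_codom ?card_ord //.
by apply: eq_bigr => g _; congr (_ * _); apply: eq_bigr => B _;
  rewrite nth_codom_ord.
Qed.

Lemma free_cumulant_unique (R : seq A -> K) s :
  free_moment_cumulant psi R -> (0 < size s)%N -> R s = free_cumulant psi s.
Proof.
move=> RP; have [m] := ubnP (size s); elim: m s => // m IH s sm s0.
have key n (a : 'I_n -> A) : (0 < n)%N ->
    \sum_(g in NC n) \prod_(B in g) R [seq a i | i in B] =
    \sum_(g in NC n) \prod_(B in g) free_cumulant psi [seq a i | i in B].
  by case: n a => // n a _; rewrite -RP -free_cumulantP.
have sT : [set setT] \in NC (size s).
  by case: (size s) s0 => // k _; apply: NC_setT.
rewrite -(image_setT s); move: (key _ (fun i : 'I_(size s) => s`_i) s0).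
rewrite (bigD1 [set setT]) //= [X in _ = X -> _](bigD1 [set setT]) //=.
rewrite !big_set1.
under eq_bigr => g /andP[gN gT].
  under eq_bigr => B Bg.
    have /andP[B0 Bs] := NC_block_size gN gT Bg.
    rewrite IH ?size_image ?(leq_trans Bs) //; over.
  over.
by move/addIr.
Qed.

Lemma cfree_cumulant_unique (cR : seq A -> K) s :
  cfree_moment_cumulant phi (free_cumulant psi) cR -> (0 < size s)%N ->
  cR s = cfree_cumulant phi psi s.
Proof.
move=> RP; have [m] := ubnP (size s); elim: m s => // m IH s sm s0.
have key n (a : 'I_n -> A) (T := fun c : seq A -> K => \sum_(g in NC n)
    ((\prod_(D in g | ~~ interior_block g D) c [seq a i | i in D]) *
     (\prod_(B in g | interior_block g B)
        free_cumulant psi [seq a i | i in B]))) : (0 < n)%N ->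
    T cR = T (cfree_cumulant phi psi).
  by rewrite {}/T; case: n a => // n a _; rewrite -RP -cfree_cumulantP.
have sT : [set setT] \in NC (size s).
  by case: (size s) s0 => // k _; apply: NC_setT.
rewrite -(image_setT s); move: (key _ (fun i : 'I_(size s) => s`_i) s0) => /=.
rewrite (bigD1 [set setT]) //= [X in _ = X -> _](bigD1 [set setT]) //=.
rewrite !(big_mkcondr _ _ (mem [set setT])) /= !big_set1 interior_block_set1 /=.
rewrite !mulr1.
under eq_bigr => g /andP[gN gT].
  under eq_bigr => B /andP[Bg _].
    have /andP[B0 Bs] := NC_block_size gN gT Bg.
    rewrite IH ?size_image ?(leq_trans Bs) //; over.
  over.
by move/addIr.
Qed.
End CumulantFormulas.

(* A formal power series is the sequence of its coefficients. *)
Definition fps (K : Type) := nat -> K.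

Section FormalPowerSeries.
Variable K : fieldType.
Implicit Types F G : fps K.

Definition fpsX : fps K := fun n => (n == 1%N)%:R.

Definition fps_mul F G : fps K :=
  fun n => \sum_(i < n.+1) F i * G (n - i)%N.

(* F(z) / z, for F with zero constant term. *)
Definition fps_divX F : fps K := fun n => F n.+1.

(* F(G(z)), for G with zero constant term: the coefficient of z^n only depends
   on the coefficients of F and G up to degree n. *)
Definition fps_comp F G : fps K :=
  fun n => ((\poly_(i < n.+1) F i) \Po (\poly_(i < n.+1) G i))`_n.

Definition is_fps_comp_inv F G : Prop :=
  [/\ G 0%N = 0, fps_comp F G = fpsX & fps_comp G F = fpsX].

Definition fps_comp_inv F : fps K :=
  classical_sets.xget (fun=> 0) (is_fps_comp_inv F).

End FormalPowerSeries.

Section CompositionalInverse.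
Variable K : fieldType.
Implicit Types (F G H : fps K) (p q : {poly K}).

Let trunc n F := \poly_(i < n) F i.
(* [p] and [F] have the same coefficients in degrees < n. *)
Let agree n p F := forall i, (i < n)%N -> p`_i = F i.

Let agree_trunc n F : agree n (trunc n F) F.
Proof. by move=> i lt_in; rewrite coef_poly lt_in. Qed.

Let coef_exp0 p k n : p`_0 = 0 -> (n < k)%N -> (p ^+ k)`_n = 0.
Proof.
move=> p0; elim: k n => // k IH n; rewrite ltnS => nk.
rewrite exprS coefM big1 // => -[[|i] /= ilt] _; first by rewrite p0 mul0r.
by rewrite IH ?mulr0 // (leq_trans _ nk) // ltn_subrL /= (leq_trans (ltn0Sn i)).
Qed.

Let coef_comp0 p q n m : q`_0 = 0 -> (n < m)%N ->
  (p \Po q)`_n = \sum_(i < m) p`_i * (q ^+ i)`_n.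
Proof.
move=> q0 nm; rewrite coef_comp_poly.
pose f i := p`_i * (q ^+ i)`_n.
have E a b : (forall i, (a <= i)%N -> f i = 0) -> (a <= b)%N ->
    \sum_(i < b) f i = \sum_(i < a) f i.
  move=> f0 ab; rewrite (big_ord_widen _ f ab) [RHS]big_mkcond /=.
  by apply: eq_bigr => i _; case: ltnP => // /f0.
have [le|/ltnW le] := leqP (size p) m.
  by rewrite [RHS](E (size p)) // => i si; rewrite /f nth_default ?mul0r.
by rewrite [LHS](E m) // => i si; rewrite /f coef_exp0 ?mulr0 ?(leq_trans nm).
Qed.

Let coef_exp_agree n p q k : (forall i, (i < n)%N -> p`_i = q`_i) ->
  forall i, (i < n)%N -> (p ^+ k)`_i = (q ^+ k)`_i.
Proof.
move=> pq; elim: k => [//|k IH] i lt_in; rewrite !exprS !coefM.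
apply: eq_bigr => j _; rewrite pq ?IH //.
  by rewrite (leq_ltn_trans (leq_subr _ _)).
by rewrite (leq_ltn_trans _ lt_in) // -ltnS.
Qed.

Lemma fps_comp_coef F G p q n : G 0%N = 0 ->
  (forall i, (i <= n)%N -> p`_i = F i) -> (forall i, (i <= n)%N -> q`_i = G i) ->
  fps_comp F G n = (p \Po q)`_n.
Proof.
move=> G0 pF qG; have q0 : q`_0 = 0 by rewrite qG.
have t0 : (trunc n.+1 G)`_0 = 0 by rewrite agree_trunc.
rewrite /fps_comp (@coef_comp0 _ _ n n.+1) // (@coef_comp0 p q n n.+1) //.
apply: eq_bigr => i _; rewrite agree_trunc // pF -1?ltnS //; congr (_ * _).
apply: (@coef_exp_agree n.+1) => // j jn; by rewrite agree_trunc // qG.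
Qed.

Lemma fps_comp_0 F G : G 0%N = 0 -> fps_comp F G 0%N = F 0%N.
Proof.
move=> G0; rewrite /fps_comp (@coef_comp0 _ _ 0 1) ?coef_poly //.
by rewrite big_ord1 expr0 coef1 mulr1 coef_poly.
Qed.

Lemma fps_compA F G H : G 0%N = 0 -> H 0%N = 0 ->
  fps_comp (fps_comp F G) H = fps_comp F (fps_comp G H).
Proof.
move=> G0 H0; apply/funext => n.
pose f := trunc n.+1 F; pose g := trunc n.+1 G; pose h := trunc n.+1 H.
have sub i : (i <= n)%N -> forall j, (j <= i)%N -> (j < n.+1)%N.
  by move=> ? j ?; rewrite ltnS (@leq_trans i).
rewrite (@fps_comp_coef _ _ (f \Po g) h) //; first last.
- by move=> i ?; apply: agree_trunc.
- move=> i ile; rewrite (@fps_comp_coef _ _ f g) // => j jle.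
    by apply: agree_trunc; apply: sub jle.
  by apply: agree_trunc; apply: sub jle.
rewrite (@fps_comp_coef _ _ f (g \Po h)) ?comp_polyA //.
- by rewrite fps_comp_0.
- by move=> i ?; apply: agree_trunc.
- move=> i ile; rewrite (@fps_comp_coef _ _ g h) // => j jle.
    by apply: agree_trunc; apply: sub jle.
  by apply: agree_trunc; apply: sub jle.
Qed.

Lemma fps_compX F : fps_comp F (fpsX K) = F.
Proof.
apply/funext => n; rewrite (@fps_comp_coef _ _ (trunc n.+1 F) 'X) //.
- by rewrite comp_polyXr agree_trunc.
- by move=> i ?; apply: agree_trunc.
- by move=> i _; rewrite coefX.
Qed.

Lemma fps_compXl F : F 0%N = 0 -> fps_comp (fpsX K) F = F.
Proof.
move=> F0; apply/funext => n; rewrite (@fps_comp_coef _ _ 'X (trunc n.+1 F)) //.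
- by rewrite comp_polyX agree_trunc.
- by move=> i _; rewrite coefX.
- by move=> i ?; apply: agree_trunc.
Qed.

Let right_inverse F : F 0%N = 0 -> F 1%N != 0 ->
  exists G, [/\ G 0%N = 0, G 1%N != 0 & fps_comp F G = fpsX K].
Proof.
move=> F0 F1.
pose c (p : {poly K}) (n : nat) : K := ((n == 1%N)%:R - (trunc n.+1 F \Po p)`_n) / F 1%N.
have [g [g0 gS]] : exists g : nat -> {poly K}, g 0%N = 0 /\
    forall n, g n.+1 = g n + c (g n) n.+1 *: 'X^(n.+1).
  by exists (fix g n := if n is m.+1 then g m + c (g m) m.+1 *: 'X^(m.+1) else 0).
pose G : fps K := fun n => (g n)`_n.
have gG n m : (m <= n)%N -> (g n)`_m = G m.
  elim: n => [|n IH]; first by rewrite leqn0 => /eqP->.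
  rewrite leq_eqVlt => /predU1P[->//|mn].
  by rewrite gS coefD coefZ coefXn ltn_eqF // mulr0 addr0 IH.
have gsz n m : (n < m)%N -> (g n)`_m = 0.
  elim: n => [|n IH] nm; first by rewrite g0 coef0.
  by rewrite gS coefD IH ?(ltnW nm) // coefZ coefXn gtn_eqF // mulr0 addr0.
have G0 : G 0%N = 0 by rewrite /G g0 coef0.
have gn0 n : (g n)`_0 = 0 by rewrite gG.
have GF : fps_comp F G = fpsX K.
  apply/funext => -[|n]; first by rewrite fps_comp_0.
  rewrite (@fps_comp_coef _ _ (trunc n.+2 F) (g n.+1)) //; first last.
  - by move=> i ?; apply: gG.
  - by move=> i ?; apply: agree_trunc.
  suff -> : (trunc n.+2 F \Po g n.+1)`_n.+1 =
      (trunc n.+2 F \Po g n)`_n.+1 + F 1%N * c (g n) n.+1.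
    by rewrite /c mulrC divfK // addrC subrK.
  rewrite !(@coef_comp0 _ _ n.+1 n.+2) //.
  rewrite (bigD1 (@Ordinal n.+2 1 isT)) //= [in RHS](bigD1 (@Ordinal n.+2 1 isT)) //=.
  rewrite !expr1 gS coefD coefZ coefXn eqxx mulr1 agree_trunc // mulrDr.
  rewrite -[RHS]addrA [X in _ = _ + X]addrC [RHS]addrA; congr (_ + _).
  apply: eq_bigr => -[[|[|k]] klt] //= _.
  congr (_ * _); apply/eqP; rewrite -subr_eq0 -coefB.
  rewrite subrXX [_ - g n]addrC addKr -scalerAl coefZ coefXnM ltnn subnn.
  rewrite coef_sum big1 ?mulr0 // => i _.
  rewrite -!horner_coef0 hornerM !horner_exp !horner_coef0 -gS !gn0.
  case: i => -[|i] /= ilt; first by rewrite subn0 exprS !mul0r.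
  by rewrite [0 ^+ i.+1]exprS mul0r mulr0.
exists G; split=> //; have := congr1 (fun u => u 1%N) GF.
rewrite /fps_comp (@coef_comp0 _ _ 1 2) ?coef_poly ?G0 //.
rewrite !big_ord_recl big_ord0 /= expr0 coef1 expr1 mulr0 add0r addr0.
rewrite !coef_poly /= /bump /= => FG; apply/eqP => G10; move: FG.
by rewrite G10 mulr0 /fpsX eqxx => /eqP; rewrite eq_sym oner_eq0.
Qed.

Lemma fps_comp_invP F : F 0%N = 0 -> F 1%N != 0 ->
  is_fps_comp_inv F (fps_comp_inv F).
Proof.
move=> F0 F1; apply: classical_sets.xgetPex.
have [G [G0 G1 FG]] := right_inverse F0 F1.
have [H [H0 _ GH]] := right_inverse G0 G1.
exists G; split=> //; suff -> : F = H by [].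
by rewrite -[LHS]fps_compX -GH -fps_compA // FG fps_compXl.
Qed.

Lemma fps_comp_inv_unique F G : F 0%N = 0 -> F 1%N != 0 ->
  is_fps_comp_inv F G -> G = fps_comp_inv F.
Proof.
move=> F0 F1 [G0 _ GF]; have [H0 FH _] := fps_comp_invP F0 F1.
by rewrite -[LHS]fps_compX -FH -fps_compA // GF fps_compXl.
Qed.

End CompositionalInverse.

Section CumulantSeries.
Variables (K : fieldType) (A : algType K).
Implicit Types (W : A) (phi psi : {scalar A}).

Definition R_series psi W : fps K :=
  fun n => if n is m.+1 then free_cumulant psi (nseq m.+1 W) else 0.

Definition cR_series phi psi W : fps K :=
  fun n => if n is m.+1 then cfree_cumulant phi psi (nseq m.+1 W) else 0.

End CumulantSeries.

(* Main.v *)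
Require Import Defs.
From HB Require Import structures.
From mathcomp Require Import all_boot all_order all_algebra.
From mathcomp Require Import boolp ring zify.
From mathcomp Require Import reals complex.

Set Implicit Arguments.
Unset Strict Implicit.
Unset Printing Implicit Defensive.

Import GRing.Theory.
Local Open Scope ring_scope.

(** Let [s] be the series with [1 + psi(X s + X^2 s^2 + ...) = 1 + z], let
    [h_X = 1 + phi(X s + X^2 s^2 + ...)], and define [t], [h_Y], [rho], [h_XY]
    in the same way for [Y] and [X Y].

    Splitting a non-crossing partition at the second element of its first
    block turns the moment-cumulant formulas into
    [R_X^<-1> = s (1 + z)] and [h_X - 1 = h_X s T_X], where [T_X] is the series
    of the theorem; similarly for [Y] and [X Y].

    Following Haagerup's proof of the multiplicativity of the S-transform,
    write [U = (1 - s X)^-1 = 1 + z + z a] and [V = (1 - t Y)^-1 = 1 + z + z b]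
    in [A[[z]]]; by the choice of [s] and [t], psi vanishes on [a] and [b].
    With [rho = s t (1 + z) / z] one finds
    [U (1 - rho X Y) V = 1 + z - z a b], so that
    [(1 - rho X Y)^-1 = V (1 + z - z a b)^-1 U] is a combination of alternating
    words in [a] and [b].  By c-freeness,
    [h_XY (1 + z - z phi(a) phi(b)) = h_X h_Y], and the same computation with
    [psi] in place of [phi] shows that [rho] is indeed the series attached to
    [X Y].  Eliminating [h_X], [h_Y] and [h_XY] gives [T_XY = T_X T_Y]. *)

(** * Formal power series *)

(** Ring structures require decidable equality and choice; on a function type both come from the
    classical axioms. *)
HB.instance Definition _ (T : Type) := gen_eqMixin (fps T).
HB.instance Definition _ (T : Type) := gen_choiceMixin (fps T).

Section FpsRing.
Variable T : nzRingType.
Implicit Types F G H : fps T.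

Definition fps0 : fps T := fun=> 0.
Definition fps1 : fps T := fun n => (n == 0)%:R.
Definition fps_add F G : fps T := fun n => F n + G n.
Definition fps_opp F : fps T := fun n => - F n.
(** Same formula as [fps_mul], but over any ring, since it also serves in A[[z]]; over a field the
    two are convertible. *)
Definition fps_conv F G : fps T := fun n => \sum_(i < n.+1) F i * G (n - i)%N.

Let trunc n F := \poly_(i < n.+1) F i.

(** Low coefficients of a product only see truncations of the factors, so associativity is inherited
    from polynomials. *)
Let fps_conv_trunc m n F G : (n <= m)%N ->
  fps_conv F G n = (trunc m F * trunc m G)`_n.
Proof.
move=> nm; rewrite coefM; apply: eq_bigr => i _.
have im : (i < m.+1)%N := leq_trans (ltn_ord i) (nm : n < m.+1)%N.
by rewrite !coef_poly im ltnS (leq_trans (leq_subr _ _) nm).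
Qed.

Fact fps_addA : associative fps_add.
Proof. by move=> F G H; apply/funext => n; apply: addrA. Qed.
Fact fps_addC : commutative fps_add.
Proof. by move=> F G; apply/funext => n; apply: addrC. Qed.
Fact fps_add0 : left_id fps0 fps_add.
Proof. by move=> F; apply/funext => n; apply: add0r. Qed.
Fact fps_addN : left_inverse fps0 fps_opp fps_add.
Proof. by move=> F; apply/funext => n; apply: addNr. Qed.

HB.instance Definition _ :=
  GRing.isZmodule.Build (fps T) fps_addA fps_addC fps_add0 fps_addN.

Fact fps_convA : associative fps_conv.
Proof.
move=> F G H; apply/funext => n.
transitivity (trunc n F * trunc n G * trunc n H)`_n.
  rewrite -mulrA coefM; apply: eq_bigr => i _.
  by rewrite (fps_conv_trunc (m := n)) ?leq_subr // coef_poly ltn_ord.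
rewrite coefM; apply: eq_bigr => i _.
by rewrite (fps_conv_trunc (m := n)) -1?ltnS // coef_poly ltnS leq_subr.
Qed.
Fact fps_mul1 : left_id fps1 fps_conv.
Proof.
move=> F; apply/funext => n; rewrite /fps_conv big_ord_recl /= subn0 mul1r big1 ?addr0 //.
by move=> i _; rewrite mul0r.
Qed.
Fact fps_mulr1 : right_id fps1 fps_conv.
Proof.
move=> F; apply/funext => n; rewrite /fps_conv big_ord_recr /= subnn mulr1 big1 ?add0r //.
by move=> i _; rewrite /fps1 subn_eq0 leqNgt ltn_ord mulr0.
Qed.
Fact fps_mulDl : left_distributive fps_conv fps_add.
Proof.
move=> F G H; apply/funext => n; rewrite /fps_add /fps_conv -big_split.
by apply: eq_bigr => i _; rewrite mulrDl.
Qed.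
Fact fps_mulDr : right_distributive fps_conv fps_add.
Proof.
move=> F G H; apply/funext => n; rewrite /fps_add /fps_conv -big_split.
by apply: eq_bigr => i _; rewrite mulrDr.
Qed.
Fact fps_one_neq0 : fps1 != fps0.
Proof. by apply/eqP => /(congr1 (@^~ 0%N))/eqP; rewrite oner_eq0. Qed.

HB.instance Definition _ := GRing.Zmodule_isNzRing.Build (fps T)
  fps_convA fps_mul1 fps_mulr1 fps_mulDl fps_mulDr fps_one_neq0.

Lemma fpsM F G n : (F * G) n = \sum_(i < n.+1) F i * G (n - i)%N.
Proof. by []. Qed.
Lemma fpsD F G n : (F + G) n = F n + G n.
Proof. by []. Qed.
Lemma fps_coef1 n : (1 : fps T) n = (n == 0)%:R.
Proof. by []. Qed.
Lemma fpsB F G n : (F - G) n = F n - G n.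
Proof. by []. Qed.
Lemma fps_coef0 n : (0 : fps T) n = 0.
Proof. by []. Qed.

Lemma fps_sum I (r : seq I) (P : pred I) (E : I -> fps T) n :
  (\sum_(i <- r | P i) E i) n = \sum_(i <- r | P i) E i n.
Proof. by elim/big_ind2: _ => // F x G y <- <-. Qed.

Definition fpsz : fps T := fun n => (n == 1%N)%:R.

Lemma fpszM F n : (fpsz * F) n = if n is m.+1 then F m else 0.
Proof.
rewrite fpsM; case: n => [|n]; first by rewrite big_ord1 mul0r.
rewrite big_ord_recl mul0r add0r big_ord_recl /= mul1r subn1 big1 ?addr0 //.
by move=> i _; rewrite mul0r.
Qed.

Lemma fpsMz F n : (F * fpsz) n = if n is m.+1 then F m else 0.
Proof.
rewrite fpsM; case: n => [|n]; first by rewrite big_ord1 mulr0.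
rewrite big_ord_recr /= subnn mulr0 addr0 big_ord_recr /= subSnn mulr1.
rewrite big1 ?add0r // => i _.
by rewrite subSn ?(ltnW (ltn_ord i)) // /fpsz eqSS subn_eq0 leqNgt ltn_ord mulr0.
Qed.

Lemma fpsz_comm F : fpsz * F = F * fpsz.
Proof. by apply/funext => n; rewrite fpszM fpsMz. Qed.

Lemma fps_zX k F n : (fpsz ^+ k * F) n = if (k <= n)%N then F (n - k)%N else 0.
Proof.
elim: k n => [|k IH] n; first by rewrite mul1r subn0.
by rewrite exprS -mulrA fpszM; case: n => [|n]; rewrite ?IH.
Qed.

Definition fps_const (a : T) : fps T := fun n => if n is _.+1 then 0 else a.

Lemma fps_constM (a : T) F n : (fps_const a * F) n = a * F n.
Proof.
rewrite fpsM big_ord_recl subn0 big1 ?addr0 // => i _; exact: mul0r.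
Qed.

Lemma fpsM_const (a : T) F n : (F * fps_const a) n = F n * a.
Proof.
rewrite fpsM big_ord_recr /= subnn big1 ?add0r // => i _.
by rewrite -(subnSK (ltn_ord i)) mulr0.
Qed.

Lemma fps_const_mul (a b : T) : fps_const (a * b) = fps_const a * fps_const b.
Proof. by apply/funext => -[|n]; rewrite fps_constM ?mulr0. Qed.

Lemma fps_divXK F : F 0%N = 0 -> exists G, F = fpsz * G.
Proof.
by move=> F0; exists (fun n => F n.+1); apply/funext => -[|n]; rewrite fpszM.
Qed.

Lemma fpsz_lreg : GRing.lreg fpsz.
Proof.
by move=> F G FG; apply/funext => n; have := congr1 (@^~ n.+1) FG; rewrite !fpszM.
Qed.

(** z-adic separatedness: it replaces a passage to the limit when a recursion gains a factor z at
    each step. *)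
Lemma fps_eq0 F : (forall k, exists G, F = fpsz ^+ k * G) -> F = 0.
Proof.
move=> dvd; apply/funext => n; have [G ->] := dvd n.+1.
by rewrite fps_zX ltnn.
Qed.

Lemma fps_1Bz_inv F : exists G, (1 - fpsz * F) * G = 1.
Proof.
(* [step] appends to the list of known coefficients the next one, which the equation forces. *)
pose step (s : seq T) := rcons s ((size s == 0)%:R +
  \sum_(i < size s) F i * s`_(size s - i.+1)).
pose g n := (iter n.+1 step [::])`_n.
have sz n : size (iter n step [::]) = n.
  by elim: n => //= n IH; rewrite size_rcons IH.
have gE n m : (m < n)%N -> (iter n step [::])`_m = g m.
  elim: n => // n IH; rewrite ltnS leq_eqVlt => /predU1P[->//|mn].
  by rewrite iterS {1}/step nth_rcons sz mn IH.
exists g; apply/funext => n; rewrite mulrBl mul1r -mulrA fpsB fpszM fps_coef1.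
rewrite {1}/g iterS {1}/step nth_rcons sz ltnn eqxx.
case: n => [|n]; first by rewrite big_ord0 addr0 subr0.
rewrite add0r; apply/eqP; rewrite subr_eq0; apply/eqP.
by apply: eq_bigr => i _; rewrite gE subSS // ltnS leq_subr.
Qed.

(** The difference [G - H] equals [fpsz * F * (G - H)], and [fpsz] commutes with [F], so every power
    of [fpsz] divides it. *)
Lemma fps_1Bz_lreg F G H : (1 - fpsz * F) * G = (1 - fpsz * F) * H -> G = H.
Proof.
move=> /eqP; rewrite -subr_eq0 -mulrBr mulrBl mul1r subr_eq0 => /eqP E.
apply/subr0_eq/fps_eq0; elim=> [|k [K KE]]; first by exists (G - H); rewrite mul1r.
exists (F * K); rewrite E KE exprS -!mulrA [in LHS](mulrA F).
by rewrite (commrX k (esym (fpsz_comm F))) -!mulrA.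
Qed.
End FpsRing.

Section FpsCom.
Variable T : comNzRingType.
Fact fps_mulC : @commutative (fps T) _ *%R.
Proof.
move=> F G; apply/funext => n; rewrite !fpsM.
rewrite (reindex_inj rev_ord_inj) /=; apply: eq_bigr => i _.
by rewrite mulrC subKn // -ltnS.
Qed.
HB.instance Definition _ := GRing.PzRing_hasCommutativeMul.Build (fps T) fps_mulC.
End FpsCom.

Section FpsField.
Variable K : fieldType.
Implicit Types F G H : fps K.

(** The lowest nonzero coefficients of the factors multiply to a nonzero coefficient of the
    product. *)
Lemma fps_mul_neq0 F G : F != 0 -> G != 0 -> F * G != 0.
Proof.
have ord H : H != 0 -> exists n, H n != 0 /\ forall i, (i < n)%N -> H i = 0.
  move=> H0; have ex : exists n, H n != 0.
    apply: contra_notP (elimN eqP H0) => /forallNP H0'; apply/funext => n.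
    by apply/eqP/negPn/negP/H0'.
  case: (ex_minnP ex) => n Hn nmin; exists n; split=> // i lin.
  by apply/eqP/negPn/negP => /nmin; rewrite leqNgt lin.
move=> /ord[m [Fm mmin]] /ord[n [Gn nmin]].
apply/eqP => /(congr1 (@^~ (m + n)%N)); rewrite fpsM fps_coef0.
have mlt : (m < (m + n).+1)%N by rewrite ltnS leq_addr.
rewrite (bigD1 (Ordinal mlt)) //= addKn big1 ?addr0 => [/eqP|i].
  by rewrite mulf_eq0 (negbTE Fm) (negbTE Gn).
rewrite -val_eqE /= neq_ltn => /orP[im|mi]; first by rewrite mmin ?mul0r.
have imn : (i <= m + n)%N by rewrite -ltnS.
by rewrite nmin ?mulr0 // ltn_subLR // ltn_add2r.
Qed.

Lemma fps_mulfI F G H : F != 0 -> F * G = F * H -> G = H.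
Proof.
move=> F0 /eqP; rewrite -subr_eq0 -mulrBr => /eqP FGH.
by apply/subr0_eq/eqP/negPn/negP => /(fps_mul_neq0 F0); rewrite FGH eqxx.
Qed.
End FpsField.

(** * Composition as a ring morphism in its left argument *)

Section Composition.
Variable K : fieldType.
Implicit Types F G H s : fps K.

Let trunc n F := \poly_(i < n.+1) F i.

Let coef_trunc n F i : (i <= n)%N -> (trunc n F)`_i = F i.
Proof. by move=> le_in; rewrite coef_poly ltnS le_in. Qed.

Let coef_truncM n F G i : (i <= n)%N -> (trunc n F * trunc n G)`_i = (F * G) i.
Proof.
move=> le_in; rewrite coefM fpsM; apply: eq_bigr => j _.
by rewrite !coef_trunc ?(leq_trans (leq_subr _ _)) ?(leq_trans (leq_ord j)).
Qed.

Let coef_truncX n F k : (trunc n F ^+ k)`_n = (F ^+ k) n.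
Proof.
suff E i : (i <= n)%N -> (trunc n F ^+ k)`_i = (F ^+ k) i by apply: E.
elim: k i => [|k IH] i le_in; first by rewrite coef1.
rewrite !exprS coefM fpsM; apply: eq_bigr => j _.
by rewrite coef_trunc ?IH ?(leq_trans (leq_subr _ _)) ?(leq_trans (leq_ord j)).
Qed.

Lemma fps_expX0 s k n : s 0%N = 0 -> (n < k)%N -> (s ^+ k) n = 0.
Proof.
move=> /fps_divXK[t ->] lt_nk; rewrite exprMn_comm; last exact: fpsz_comm.
by rewrite fps_zX leqNgt lt_nk.
Qed.

(** The power [s ^+ k] starts in degree at least k, so every bound [m] above [n] gives the same sum;
    this freedom lets different degrees share one range. *)
Lemma fps_compE F s n m : s 0%N = 0 -> (n < m)%N ->
  fps_comp F s n = \sum_(k < m) F k * (s ^+ k) n.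
Proof.
move=> s0 lt_nm; rewrite /fps_comp -/(trunc n s) poly_def raddf_sum coef_sum.
pose f k := F k * (s ^+ k) n; transitivity (\sum_(k < n.+1) f k).
  by apply: eq_bigr => k _; rewrite /= comp_polyZ comp_Xn_poly coefZ coef_truncX.
rewrite (big_ord_widen _ f lt_nm) big_mkcond /=.
by apply: eq_bigr => k _; case: ltnP => // nk; rewrite fps_expX0 // mulr0.
Qed.

Lemma fps_compM F G s : s 0%N = 0 ->
  fps_comp (F * G) s = fps_comp F s * fps_comp G s.
Proof.
move=> s0; apply/funext => n.
rewrite (@fps_comp_coef _ _ _ (trunc n F * trunc n G) (trunc n s)) //;
  [|exact: coef_truncM|exact: coef_trunc].
rewrite comp_polyM coefM fpsM; apply: eq_bigr => i _.
have E H m : (m <= n)%N -> (trunc n H \Po trunc n s)`_m = fps_comp H s m.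
  by move=> mn; rewrite -(@fps_comp_coef _ H s) // => j jm;
    rewrite coef_trunc // (leq_trans jm).
by rewrite !E ?leq_subr ?leq_ord.
Qed.

Lemma fps_compD F G s : s 0%N = 0 ->
  fps_comp (F + G) s = fps_comp F s + fps_comp G s.
Proof.
move=> s0; apply/funext => n; rewrite fpsD !(fps_compE _ s0 (ltnSn n)) -big_split.
by apply: eq_bigr => k _; rewrite fpsD mulrDl.
Qed.

Lemma fps_comp1 s : s 0%N = 0 -> fps_comp 1 s = 1.
Proof.
move=> s0; apply/funext => n; rewrite (fps_compE _ s0 (ltnSn n)) big_ord_recl.
by rewrite mul1r big1 ?addr0 // => i _; rewrite mul0r.
Qed.

Lemma fps_comp_z s : s 0%N = 0 -> fps_comp (fpsz K) s = s.
Proof. exact: fps_compXl. Qed.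

End Composition.

(** * Series with coefficients in the algebra, and resolvents *)

Section FpsAlgebra.
Variables (K : fieldType) (A : algType K).
Implicit Types (F G s : fps K) (P Q : fps A) (a W : A).

Definition fps_map (f : A -> K) P : fps K := fun n => f (P n).
(** The embedding of K[[z]] into A[[z]]; its image is central by [fps_scalC]. *)
Definition fps_scal F : fps A := fun n => (F n)%:A.
Lemma fps_scalM_coef F P n : (fps_scal F * P) n = \sum_(i < n.+1) F i *: P (n - i)%N.
Proof. by rewrite fpsM; apply: eq_bigr => i _; rewrite -scalerAl mul1r. Qed.

Lemma fps_scalM F G : fps_scal (F * G) = fps_scal F * fps_scal G.
Proof.
apply/funext => n; rewrite fps_scalM_coef /fps_scal fpsM scaler_suml.
by apply: eq_bigr => i _; rewrite scalerA.
Qed.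

Lemma fps_scalD F G : fps_scal (F + G) = fps_scal F + fps_scal G.
Proof. by apply/funext => n; apply: scalerDl. Qed.

Lemma fps_scal1 : fps_scal 1 = 1.
Proof. by apply/funext => n; rewrite /fps_scal !fps_coef1 scaler_nat. Qed.

Lemma fps_scal_z : fps_scal (fpsz K) = fpsz A.
Proof. by apply/funext => n; rewrite /fps_scal /fpsz scaler_nat. Qed.

Lemma fps_scalC F P : fps_scal F * P = P * fps_scal F.
Proof.
apply/funext => n; rewrite fps_scalM_coef fpsM (reindex_inj rev_ord_inj) /=.
apply: eq_bigr => i _.
by rewrite subSS subKn -1?ltnS // -scalerAr mulr1.
Qed.

Variable phi : {scalar A}.

Lemma fps_mapD P Q : fps_map phi (P + Q) = fps_map phi P + fps_map phi Q.
Proof. by apply/funext => n; apply: linearD. Qed.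

Lemma fps_map_scal F P : fps_map phi (fps_scal F * P) = F * fps_map phi P.
Proof.
apply/funext => n; rewrite /fps_map fps_scalM_coef linear_sum fpsM.
by apply: eq_bigr => i _; rewrite linearZ.
Qed.

Lemma fps_map1 : phi 1 = 1 -> fps_map phi 1 = 1.
Proof.
move=> phi1; apply/funext => n; rewrite /fps_map !fps_coef1.
by rewrite raddfMn /= phi1.
Qed.

(** The geometric series of [s W], that is (1 - s W)^-1; when [s] has no constant term, only k <= n
    contribute in degree n. *)
Definition fps_resolvent (s : fps K) W : fps A :=
  fun n => \sum_(k < n.+1) (s ^+ k) n *: W ^+ k.

Lemma fps_resolventE s W n m : s 0%N = 0 -> (n < m)%N ->
  fps_resolvent s W n = \sum_(k < m) (s ^+ k) n *: W ^+ k.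
Proof.
move=> s0 lt_nm; pose f k := (s ^+ k) n *: W ^+ k.
rewrite /fps_resolvent (big_ord_widen _ f lt_nm) big_mkcond /=.
by apply: eq_bigr => k _; case: ltnP => // nk; rewrite fps_expX0 // scale0r.
Qed.

Lemma fps_resolventP s W : s 0%N = 0 ->
  (1 - fps_scal s * fps_const W) * fps_resolvent s W = 1.
Proof.
move=> s0; rewrite mulrBl mul1r; apply/eqP; rewrite subr_eq; apply/eqP.
apply/funext => n; rewrite fpsD -mulrA fps_scalM_coef.
under eq_bigr => i _.
  rewrite fps_constM (fps_resolventE _ (m := n.+1) s0) ?ltnS ?leq_subr //.
  rewrite mulr_sumr scaler_sumr.
  under eq_bigr => k _ do rewrite -scalerAr scalerA -exprS.
  over.
(* The left-hand resolvent is expanded up to k = n + 1, so that removing its term k = 0 leaves the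
   same range as on the right. *)
rewrite exchange_big (fps_resolventE _ (m := n.+2) s0) //.
rewrite big_ord_recl !expr0 scaler_nat fps_coef1; congr (_ + _).
apply: eq_bigr => k _; rewrite -scaler_suml; congr (_ *: _).
by rewrite exprS fpsM.
Qed.

Lemma fps_resolvent_comm s W :
  fps_const W * fps_resolvent s W = fps_resolvent s W * fps_const W.
Proof.
apply/funext => n; rewrite fps_constM fpsM_const mulr_sumr mulr_suml.
by apply: eq_bigr => k _; rewrite -scalerAr -scalerAl -exprS exprSr.
Qed.

(** The bridge between resolvents in A[[z]] and moment series composed with [s]. *)
Lemma fps_map_resolvent s W : s 0%N = 0 ->
  fps_map phi (fps_resolvent s W) = fps_comp (fun k => phi (W ^+ k)) s.
Proof.
move=> s0; apply/funext => n; rewrite (fps_compE _ s0 (ltnSn n)).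
by rewrite /fps_map linear_sum; apply: eq_bigr => k _; rewrite linearZ /= mulrC.
Qed.

End FpsAlgebra.

(** * Non-crossing partitions of intervals *)

(* [lia] on ordinals is slow in a large context: keep the inequalities only. *)
Ltac olia :=
  intros;
  repeat match goal with H : ?T |- _ => match type of T with Prop => lazymatch T with
    | is_true (leq _ _) => fail
    | is_true (andb _ _) => fail
    | is_true (negb (_ \in _)) => clear H
    | is_true (negb (_ \subset _)) => clear H
    | is_true (negb _) => fail
    | @eq _ (nat_of_ord _) _ => fail
    | and _ _ => fail
    | _ => clear H
  end end end;
  repeat match goal with H : ?T |- _ => match type of T with Prop => revert H end end;
  repeat match goal with |- context [nat_of_ord ?x] => generalize (nat_of_ord x) end;
  clear; lia.

Section NonCrossingPartitions.
Variable N : nat.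
Implicit Types (g h : {set {set 'I_N}}) (B D V S : {set 'I_N}) (i j : 'I_N).

(** Partitions of subsets of one fixed ['I_N]: sub-intervals can be treated without renumbering
    their elements. *)
Definition NCp S : {set {set {set 'I_N}}} :=
  [set g | partition g S && noncrossing g].

Record nc_part S g : Prop := NCPart {
  nc_n0 : forall B, B \in g -> exists x, x \in B;
  nc_sub : forall B x, B \in g -> x \in B -> x \in S;
  nc_cover : forall x, x \in S -> exists2 B, B \in g & x \in B;
  nc_eq : forall B D x, B \in g -> D \in g -> x \in B -> x \in D -> B = D;
  nc_cross : forall B D i j k l, B \in g -> D \in g -> i \in B -> j \in D ->
    k \in B -> l \in D -> (i < j < k)%N -> (k < l)%N -> B = D }.

Lemma NCpP S g : reflect (nc_part S g) (g \in NCp S).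
Proof.
rewrite inE; apply: (iffP andP) => [[/and3P[/eqP cg /trivIsetP tg g0] nc]|].
  split=> [B Bg|B x Bg xB|x|B D x Bg Dg xB xD|B D i j k l Bg Dg iB jD kB lD].
  - by apply/set0Pn; apply: contraNneq g0 => <-.
  - by rewrite -cg; apply/bigcupP; exists B.
  - by rewrite -cg => /bigcupP[B]; exists B.
  - apply/eqP/negPn/negP => /(tg _ _ Bg Dg); rewrite -setI_eq0 => /eqP BD0.
    by have := in_set0 x; rewrite -BD0 inE xB xD.
  - move=> /andP[ij jk] kl; apply/eqP/negPn/negP => BD.
    move/forall_inP/(_ _ Bg)/forall_inP/(_ _ Dg): nc; rewrite BD /= => /negP[].
    apply/exists_inP; exists i => //; apply/exists_inP; exists j => //.
    apply/exists_inP; exists k => //; apply/exists_inP; exists l => //.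
    by rewrite ij jk.
case=> n0 sub cov eqB nc; split.
  apply/and3P; split; last by apply/negP => /n0[x]; rewrite inE.
    apply/eqP/setP => x; apply/bigcupP/idP => [[B]|/cov[B]]; [exact: sub|by exists B].
  apply/trivIsetP => B D Bg Dg; apply: contraNT.
  rewrite -setI_eq0 => /set0Pn[x]; rewrite inE => /andP[xB xD].
  by apply/eqP/(eqB _ _ x).
apply/forall_inP => B Bg; apply/forall_inP => D Dg; apply/implyP.
apply: contraNN => /exists_inP[i iB /exists_inP[j jD /exists_inP[k kB /exists_inP[l lD]]]].
by move=> /and3P[ij jk kl]; apply/eqP/(nc B D i j k l) => //; rewrite ij.
Qed.

Lemma interiorP g B : reflect (exists D i j, [/\ D \in g, D != B, i \in D, j \in D &
    forall b, b \in B -> (i < b < j)%N]) (interior_block g B).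
Proof.
apply: (iffP exists_inP) => [[D Dg /andP[DB /exists_inP[i iD /exists_inP[j jD /forall_inP bB]]]]|].
  by exists D, i, j.
case=> D [i [j [Dg DB iD jD bB]]]; exists D => //; rewrite DB.
apply/exists_inP; exists i => //; apply/exists_inP; exists j => //.
exact/forall_inP.
Qed.

(** The bounds are natural numbers, so that [b] may be [N] and [a.+1] needs no ordinal. *)
Definition itv (a b : nat) : {set 'I_N} := [set i : 'I_N | (a <= i < b)%N].

Lemma itvE a b i : (i \in itv a b) = (a <= i < b)%N.
Proof. by rewrite inE. Qed.

Lemma blkE S g B i : nc_part S g -> B \in g -> i \in B -> pblock g i = B.
Proof.
move=> /NCpP; rewrite inE => /andP[/and3P[_ tg _] _]; exact: def_pblock.
Qed.
Lemma blk_in S g i : nc_part S g -> i \in S -> (pblock g i \in g) /\ (i \in pblock g i).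
Proof. by move=> ncg /(nc_cover ncg)[B Bg iB]; rewrite (blkE ncg Bg iB). Qed.

Section Merge.
Variables (a j : 'I_N) (b : nat).
Hypotheses (aj : (a < j)%N) (jb : (j < b)%N).

(* [glue] adds [a] to the block of [j]; everything between [a] and [j] becomes
   interior.  [linked] says that [j] follows [a] in its block. *)
Definition glue (p : {set {set 'I_N}} * {set {set 'I_N}}) :=
  p.1 :|: ((a |: pblock p.2 j) |: (p.2 :\ pblock p.2 j)).

Definition unglue g :=
  ([set B in g | B \subset itv a.+1 j],
   (pblock g a :\ a) |: [set B in g | B \subset itv j b]).

Definition linked g := (j \in pblock g a) &&
  [forall k in pblock g a, (k == a) || (j <= k)%N].

Lemma in_glue g1 g2 B : (B \in glue (g1, g2)) =
  [|| B \in g1, B == a |: pblock g2 j | (B != pblock g2 j) && (B \in g2)].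
Proof. by rewrite /glue !inE. Qed.

(** A new crossing would have to use [a]. A block of [g2] lies to the right of [a] and [j], so there
    [j] can take the place of [a], giving a crossing or an overlap already in [g2]. *)
Lemma glueP g1 g2 : nc_part (itv a.+1 j) g1 -> nc_part (itv j b) g2 ->
  nc_part (itv a b) (glue (g1, g2)).
Proof.
move=> nc1 nc2.
have jS : j \in itv j b by rewrite itvE leqnn.
have [Vg jV] := blk_in nc2 jS.
have H1 B x : B \in g1 -> x \in B -> (a < x < j)%N.
  by move=> Bg xB; have := nc_sub nc1 Bg xB; rewrite itvE.
have H2 B x : B \in g2 -> x \in B -> (j <= x < b)%N.
  by move=> Bg xB; have := nc_sub nc2 Bg xB; rewrite itvE.
have HV x : x \in a |: pblock g2 j -> x = a \/ x \in pblock g2 j.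
  by rewrite !inE => /predU1P.
split.
- move=> B; rewrite in_glue => /or3P[/(nc_n0 nc1)//|/eqP->|/andP[_ /(nc_n0 nc2)//]].
  by exists a; rewrite !inE eqxx.
- move=> B x; rewrite in_glue itvE => /or3P[Bg /(H1 _ _ Bg)|/eqP-> /HV[->|/(H2 _ _ Vg)]|/andP[_ Bg] /(H2 _ _ Bg)]; olia.
- move=> x; rewrite itvE => xab.
  have [xa|xna] := eqVneq x a.
    by exists (a |: pblock g2 j); rewrite ?in_glue ?eqxx ?orbT // xa !inE eqxx.
  have [xj|jx] := ltnP x j.
    have xS : x \in itv a.+1 j by move: xna; rewrite itvE -val_eqE /=; olia.
    by have [B Bg xB] := nc_cover nc1 xS; exists B => //; rewrite in_glue Bg.
  have xS : x \in itv j b by rewrite itvE; olia.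
  have [B Bg xB] := nc_cover nc2 xS.
  have [BV|BV] := eqVneq B (pblock g2 j).
    by exists (a |: pblock g2 j); rewrite ?in_glue ?eqxx ?orbT // !inE -BV xB orbT.
  by exists B => //; rewrite in_glue Bg BV !orbT.
- move=> B D x; rewrite !in_glue => /or3P[Bg|/eqP->|/andP[BV Bg]] /or3P[Dg|/eqP->|/andP[DV Dg]].
  + by move=> xB xD; apply: (nc_eq nc1 Bg Dg xB xD).
  + by move=> /(H1 _ _ Bg) + /HV[xa|/(H2 _ _ Vg)]; [rewrite xa|]; olia.
  + by move=> /(H1 _ _ Bg) + /(H2 _ _ Dg); olia.
  + by move=> + /(H1 _ _ Dg); move=> /HV[->|/(H2 _ _ Vg)]; olia.
  + by [].
  + move=> /HV[->|xV] xD; first by have := H2 _ _ Dg xD; olia.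
    by rewrite (nc_eq nc2 Vg Dg xV xD) eqxx in DV.
  + by move=> /(H2 _ _ Bg) + /(H1 _ _ Dg); olia.
  + move=> xB /HV[xa|xV]; first by have := H2 _ _ Bg xB; rewrite xa; olia.
    by rewrite (nc_eq nc2 Vg Bg xV xB) eqxx in BV.
  + by move=> xB xD; apply: (nc_eq nc2 Bg Dg xB xD).
- move=> B D x y z w; rewrite !in_glue => /or3P[Bg|/eqP->|/andP[BV Bg]] /or3P[Dg|/eqP->|/andP[DV Dg]].
  + by move=> xB yD zB wD; apply: (nc_cross nc1 Bg Dg xB yD zB wD).
  + by move=> /(H1 _ _ Bg) x1 /HV[->|/(H2 _ _ Vg) y1] /(H1 _ _ Bg); olia.
  + by move=> /(H1 _ _ Bg) x1 /(H2 _ _ Dg) y1 /(H1 _ _ Bg); olia.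
  + by move=> _ /(H1 _ _ Dg) y1 /HV[->|/(H2 _ _ Vg) z1] /(H1 _ _ Dg); olia.
  + by [].
  + move=> xV yD zV wD xyz zw.
    have yj := H2 _ _ Dg yD.
    case: (HV _ zV) => [za|zV']; first by move: xyz; rewrite za; olia.
    case: (HV _ xV) => [xa|xV'].
      have [jy|yj'] := ltnP j y.
        by rewrite (nc_cross nc2 Vg Dg jV yD zV' wD _ zw) ?jy ?eqxx in DV; olia.
      have yjE : y = j by apply: val_inj => /=; olia.
      by rewrite yjE in yD; rewrite (nc_eq nc2 Vg Dg jV yD) eqxx in DV.
    by rewrite (nc_cross nc2 Vg Dg xV' yD zV' wD xyz zw) eqxx in DV.
  + move=> /(H2 _ _ Bg) x1 /(H1 _ _ Dg); olia.
  + move=> xB yV zB wV xyz zw.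
    have xj := H2 _ _ Bg xB.
    case: (HV _ yV) => [ya|yV']; first by move: xyz; rewrite ya; olia.
    case: (HV _ wV) => [wa|wV']; first by move: xyz zw; rewrite wa; olia.
    by rewrite (nc_cross nc2 Bg Vg xB yV' zB wV' xyz zw) eqxx in BV.
  + by move=> xB yD zB wD; apply: (nc_cross nc2 Bg Dg xB yD zB wD).
Qed.

Lemma linkedP g : reflect (j \in pblock g a /\ forall k, k \in pblock g a -> k = a \/ (j <= k)%N) (linked g).
Proof.
apply: (iffP andP) => -[jV H]; split=> //.
  by move=> k /(forall_inP H)/predU1P.
by apply/forall_inP => k /H[->|->]; rewrite ?eqxx ?orbT.
Qed.

Section Unglue.
Variable g : {set {set 'I_N}}.
Hypotheses (ncg : nc_part (itv a b) g) (lg : linked g).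

Let aS : a \in itv a b. Proof. by rewrite itvE; olia. Qed.
Let V := pblock g a.
Let Vg : V \in g. Proof. by have [] := blk_in ncg aS. Qed.
Let aV : a \in V. Proof. by have [] := blk_in ncg aS. Qed.
Let jV : j \in V. Proof. by have /linkedP[] := lg. Qed.
Let Vj k : k \in V -> k = a \/ (j <= k)%N. Proof. by have /linkedP[_] := lg; apply. Qed.
Let Hg B x : B \in g -> x \in B -> (a <= x < b)%N.
Proof. by move=> Bg xB; have := nc_sub ncg Bg xB; rewrite itvE. Qed.

(** A block [B] with [x < j] and [y > j] would cross [V], because [a < x < j < y] with [a] and [j]
    in [V]. *)
Let side B : B \in g -> B != V -> (B \subset itv a.+1 j) || (B \subset itv j b).
Proof.
move=> Bg BV; have nV x : x \in B -> (x \notin V).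
  by move=> xB; apply: contraNN BV => xV; rewrite (nc_eq ncg Bg Vg xB xV).
have na x : x \in B -> (a < x)%N /\ (x < b)%N /\ x != j :> nat.
  move=> xB; have := nV x xB; have := Hg Bg xB; move=> xab xV.
  have xa : x != a by apply: contraNneq xV => ->.
  have xj : x != j by apply: contraNneq xV => ->.
  by move: xa xj; rewrite -!val_eqE /=; olia.
rewrite -[_ || _]negbK negb_or; apply/negP => /andP[/subsetPn[y yB yj] /subsetPn[x xB xj]].
move: yj xj; rewrite !itvE => yj xj; have := na x xB; have := na y yB => y1 x1.
by case/eqP: BV; apply/esym/(nc_cross ncg Vg Bg aV xB jV yB); olia.
Qed.

Let WP x : (x \in V :\ a) = (x \in V) && (j <= x)%N.
Proof.
rewrite !inE; apply/andP/andP => [[xa xV]|[xV jx]]; split=> //.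
  by case: (Vj xV) xa => [->|//]; rewrite eqxx.
by rewrite -val_eqE /=; olia.
Qed.

Lemma in_unglue1 B : (B \in (unglue g).1) = (B \in g) && (B \subset itv a.+1 j).
Proof. by rewrite inE. Qed.
Lemma in_unglue2 B : (B \in (unglue g).2) = (B == V :\ a) || (B \in g) && (B \subset itv j b).
Proof. by rewrite !inE. Qed.

Lemma unglueP : nc_part (itv a.+1 j) (unglue g).1 /\ nc_part (itv j b) (unglue g).2.
Proof.
split; split.
- by move=> B; rewrite in_unglue1 => /andP[/(nc_n0 ncg)].
- by move=> B x; rewrite in_unglue1 => /andP[_ /subsetP]; apply.
- move=> x xS; move: (xS); rewrite itvE => xaj.
  have [|B Bg xB] := nc_cover ncg (x := x); first by rewrite itvE; olia.
  have BV : B != V.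
    by apply/eqP => BV; rewrite BV in xB; case: (Vj xB) => [xa|]; [move: xaj; rewrite xa|]; olia.
  exists B => //; rewrite in_unglue1 Bg /=; case/orP: (side Bg BV) => //.
  by move/subsetP/(_ x xB); rewrite itvE; olia.
- move=> B D x; rewrite !in_unglue1 => /andP[Bg _] /andP[Dg _] xB xD.
  exact: (nc_eq ncg Bg Dg xB xD).
- move=> B D x y z w; rewrite !in_unglue1 => /andP[Bg _] /andP[Dg _] xB yD zB wD.
  exact: (nc_cross ncg Bg Dg xB yD zB wD).
- move=> B; rewrite in_unglue2 => /predU1P[->|/andP[/(nc_n0 ncg)]//].
  by exists j; rewrite WP jV leqnn.
- move=> B x; rewrite in_unglue2 => /predU1P[->|/andP[_ /subsetP H xB]]; last exact: H.
  by rewrite WP => /andP[/(Hg Vg)]; rewrite itvE; olia.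
- move=> x xS; move: (xS); rewrite itvE => xjb.
  have [|B Bg xB] := nc_cover ncg (x := x); first by rewrite itvE; olia.
  have [BV|BV] := eqVneq B V.
    by exists (V :\ a); rewrite ?in_unglue2 ?eqxx // WP -BV xB; olia.
  exists B => //; rewrite in_unglue2 Bg /=; case/orP: (side Bg BV) => [|->]; last by rewrite orbT.
  by move/subsetP/(_ x xB); rewrite itvE; olia.
- move=> B D x; rewrite !in_unglue2.
  case/predU1P=> [->|/andP[Bg Bs]]; case/predU1P=> [->|/andP[Dg Ds]] //.
  + rewrite WP => /andP[xV _] xD; have := subsetP Ds a.
    by rewrite -(nc_eq ncg Vg Dg xV xD) aV itvE => /(_ isT); olia.
  + rewrite WP => xB /andP[xV _]; have := subsetP Bs a.
    by rewrite -(nc_eq ncg Vg Bg xV xB) aV itvE => /(_ isT); olia.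
  + by move=> xB xD; apply: (nc_eq ncg Bg Dg xB xD).
- move=> B D x y z w; rewrite !in_unglue2.
  case/predU1P=> [->|/andP[Bg Bs]]; case/predU1P=> [->|/andP[Dg Ds]] //.
  + rewrite !WP => /andP[xV _] yD /andP[zV _] wD xyz zw; have := subsetP Ds a.
    by rewrite -(nc_cross ncg Vg Dg xV yD zV wD xyz zw) aV itvE => /(_ isT); olia.
  + rewrite !WP => xB /andP[yV _] zB /andP[wV _] xyz zw; have := subsetP Bs a.
    by rewrite (nc_cross ncg Bg Vg xB yV zB wV xyz zw) aV itvE => /(_ isT); olia.
  + by move=> xB yD zB wD; apply: (nc_cross ncg Bg Dg xB yD zB wD).
Qed.

Lemma unglueK : glue (unglue g) = g.
Proof.
have [nc1 nc2] := unglueP.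
have E : pblock (unglue g).2 j = V :\ a.
  by apply: (blkE nc2); rewrite ?in_unglue2 ?eqxx // WP jV leqnn.
apply/setP => B; rewrite in_glue E in_unglue1 in_unglue2 setD1K //.
apply/or3P/idP => [[/andP[]//|/eqP->//|]|Bg].
  by case/andP=> BW; rewrite (negbTE BW) => /andP[].
have [->|BV] := eqVneq B V; first by constructor 2.
case/orP: (side Bg BV) => [->|Bs]; first by rewrite Bg; constructor 1.
constructor 3; rewrite Bg Bs orbT andbT; apply/eqP => BW.
have jB : j \in B by rewrite BW WP jV leqnn.
by case/eqP: BV; apply: (nc_eq ncg Bg Vg jB jV).
Qed.
End Unglue.

Section Glue.
Variables g1 g2 : {set {set 'I_N}}.
Hypotheses (nc1 : nc_part (itv a.+1 j) g1) (nc2 : nc_part (itv j b) g2).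

Let jS : j \in itv j b. Proof. by rewrite itvE leqnn. Qed.
Let V := pblock g2 j.
Let Vg : V \in g2. Proof. by have [] := blk_in nc2 jS. Qed.
Let jV : j \in V. Proof. by have [] := blk_in nc2 jS. Qed.
Let H1 B x : B \in g1 -> x \in B -> (a < x < j)%N.
Proof. by move=> Bg xB; have := nc_sub nc1 Bg xB; rewrite itvE. Qed.
Let H2 B x : B \in g2 -> x \in B -> (j <= x < b)%N.
Proof. by move=> Bg xB; have := nc_sub nc2 Bg xB; rewrite itvE. Qed.

Lemma pblock_glue : pblock (glue (g1, g2)) a = a |: V.
Proof.
by apply: (blkE (glueP nc1 nc2)); rewrite ?in_glue ?eqxx ?orbT // !inE eqxx.
Qed.

Let aNV : a \notin V.
Proof. by apply/negP => /(H2 Vg); olia. Qed.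

Lemma linked_glue : linked (glue (g1, g2)).
Proof.
apply/linkedP; rewrite pblock_glue; split; first by rewrite !inE jV orbT.
by move=> k; rewrite !inE => /predU1P[->|/(H2 Vg)/andP[]]; [left|right].
Qed.

Lemma glueK : unglue (glue (g1, g2)) = (g1, g2).
Proof.
rewrite /unglue pblock_glue setU1K //; congr (_, _); apply/setP => B.
  rewrite !inE; apply/andP/idP => [[/or3P[//|/eqP->|/andP[_ Bg]]]|Bg].
  - by move/subsetP/(_ a); rewrite itvE !inE eqxx => /(_ isT); olia.
  - have [x xB] := nc_n0 nc2 Bg.
    by move/subsetP/(_ x xB); rewrite itvE => xj; have := H2 Bg xB; olia.
  split; first by rewrite Bg.
  by apply/subsetP => x xB; apply: nc_sub nc1 _ _ Bg xB.
rewrite !inE; apply/predU1P/idP => [[->//|/andP[/or3P[Bg|/eqP->|/andP[//]]]]|Bg].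
- have [x xB] := nc_n0 nc1 Bg.
  by move/subsetP/(_ x xB); rewrite itvE => xj; have := H1 Bg xB; olia.
- by move/subsetP/(_ a); rewrite itvE !inE eqxx => /(_ isT); olia.
have [->|BV] := eqVneq B V; [by left|right].
rewrite Bg andbT orbT /=.
have -> : B \subset itv j b by apply/subsetP => x xB; apply: nc_sub nc2 _ _ Bg xB.
by rewrite orbT.
Qed.
Let g := glue (g1, g2).
Let ncg : nc_part (itv a b) g. Proof. exact: glueP. Qed.
Let Wg : a |: V \in g. Proof. by rewrite in_glue eqxx orbT. Qed.
Let aW : a \in a |: V. Proof. by rewrite !inE eqxx. Qed.
Let jW : j \in a |: V. Proof. by rewrite !inE jV orbT. Qed.

Lemma interior_glue1 B : B \in g1 -> interior_block g B.
Proof.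
move=> Bg; apply/interiorP; exists (a |: V), a, j; split=> //; last by move=> x /(H1 Bg).
by apply/eqP => BW; move: aW; rewrite BW => /(H1 Bg); olia.
Qed.

Lemma interior_glue_min : interior_block g (a |: V) = false.
Proof.
apply/negbTE/negP => /interiorP[D [i [k [Dg _ iD _ /(_ a aW)]]]].
by have := nc_sub ncg Dg iD; rewrite itvE; olia.
Qed.

Lemma interior_min : interior_block g2 V = false.
Proof.
apply/negbTE/negP => /interiorP[D [i [k [Dg _ iD _ /(_ j jV)]]]].
by have := nc_sub nc2 Dg iD; rewrite itvE; olia.
Qed.

(** Such a block lies to the right of [j]: if [a] and [k] enclose it then so do [j] and [k], and
    blocks of [g1] end before [j]. *)
Lemma interior_glue2 B : B \in g2 -> B != V ->
  interior_block g B = interior_block g2 B.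
Proof.
move=> Bg BV; have jB x : x \in B -> (j < x)%N.
  move=> xB; have := H2 Bg xB; have : x != j.
    by apply: contraNneq BV => xj; rewrite xj in xB; rewrite (nc_eq nc2 Bg Vg xB jV).
  by rewrite -val_eqE /=; olia.
have [x0 x0B] := nc_n0 nc2 Bg.
apply/interiorP/interiorP => -[D [i [k [Dg DB iD kD lt]]]]; last first.
  have [DV|DV] := eqVneq D V.
    exists (a |: V), i, k; split=> //; rewrite -?DV ?inE ?iD ?kD ?orbT //.
    by apply/eqP => BW; move: aW; rewrite -DV BW => /jB; olia.
  by exists D, i, k; split=> //; rewrite in_glue DV Dg !orbT.
move: Dg; rewrite in_glue => /or3P[Dg|/eqP DW|/andP[DV Dg]]; last by exists D, i, k.
  by have := lt x0 x0B; have := jB x0 x0B; have := H1 Dg kD; olia.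
exists V, j, k; split=> //; first by rewrite eq_sym.
  move: kD; rewrite DW !inE => /predU1P[ka|//].
  by have := lt x0 x0B; have := jB x0 x0B; rewrite ka; olia.
by move=> x xB; rewrite jB //=; have /andP[] := lt x xB.
Qed.

Lemma big_glue (T : comPzRingType) (f : {set 'I_N} -> T) :
  \prod_(B in g) f B =
  \prod_(B in g1) f B * (f (a |: V) * \prod_(B in g2 | B != V) f B).
Proof.
rewrite (eq_bigl (mem [predU mem g1 & mem ((a |: V) |: (g2 :\ V))])); last first.
  by move=> B; rewrite !inE.
rewrite bigU; last first.
  rewrite disjoint_subset; apply/subsetP => B Bg; have [x xB] := nc_n0 nc1 Bg.
  have := H1 Bg xB; rewrite !inE => xj; apply/negP => /predU1P[BW|/andP[_ Bg2]].
    by move: aW; rewrite -BW => /(H1 Bg); olia.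
  by have := H2 Bg2 xB; olia.
congr (_ * _); rewrite big_setU1 /=.
  by congr (_ * _); apply: eq_bigl => B; rewrite !inE andbC.
by apply/negP; rewrite !inE => /andP[_ Wg2]; have := H2 Wg2 aW; olia.
Qed.

Lemma card_glue_min : #|a |: V| = #|V|.+1.
Proof. by rewrite cardsU1; case: (boolP (a \in V)) => // /(H2 Vg); olia. Qed.

End Glue.

(** [glue] and [unglue] are inverse bijections. *)
Lemma sum_linked (T : nmodType) (F : {set {set 'I_N}} -> T) :
  \sum_(g in NCp (itv a b) | linked g) F g =
  \sum_(g1 in NCp (itv a.+1 j)) \sum_(g2 in NCp (itv j b)) F (glue (g1, g2)).
Proof.
rewrite pair_big_dep /= (reindex_onto glue unglue) /=; last first.
  by move=> g /andP[/NCpP ncg lg]; rewrite unglueK.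
apply: eq_big => [[g1 g2] /=|[g1 g2]//].
apply/andP/andP => [[/andP[/NCpP ncg lg] /eqP]|[/NCpP nc1 /NCpP nc2]].
  by have [/NCpP + /NCpP +] := unglueP ncg lg => + + E; rewrite E.
by rewrite glueK // eqxx linked_glue // andbT; split=> //; apply/NCpP/glueP.
Qed.

End Merge.

(** * Weights of partitions and their recursion *)

Section Weights.
Variables (T : comPzRingType) (c r : nat -> T).

(* The block of [a] counts as if it had [d] additional elements: this is the
   block of which the recursion [wsum_rec] has already removed [d] elements. *)
Definition weight (d a : nat) g : T := \prod_(B in g)
  (if interior_block g B then r #|B|
   else c (#|B| + (if [exists x in B, x == a :> nat] then d else 0))%N).

Definition free_weight g : T := \prod_(B in g) r #|B|.

Let mark (a : 'I_N) B : [exists x in B, x == a :> nat] = (a \in B).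
Proof.
apply/exists_inP/idP => [[x xB /eqP/val_inj<-//]|aB]; by exists a.
Qed.

(** All blocks of [g1] become interior, and the exterior block of [a] has one element more than that
    of [j], which [d.+1] makes up for. *)
Lemma weight_glue (a j : 'I_N) b d g1 g2 : (a < j)%N -> (j < b)%N ->
  nc_part (itv a.+1 j) g1 -> nc_part (itv j b) g2 ->
  weight d a (glue a j (g1, g2)) = free_weight g1 * weight d.+1 j g2.
Proof.
move=> aj jb nc1 nc2; rewrite /weight (big_glue aj jb nc1 nc2); congr (_ * _).
  by apply: eq_bigr => B Bg; rewrite (interior_glue1 aj jb nc1 nc2).
have jS : j \in itv j b by rewrite itvE leqnn.
have [Vg jV] := blk_in nc2 jS.
rewrite [RHS](bigD1 (pblock g2 j)) //=; congr (_ * _).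
  rewrite (interior_glue_min aj jb nc1 nc2) (interior_min aj jb nc2) !mark jV.
  by rewrite (card_glue_min aj jb nc2) !inE eqxx addnS.
apply: eq_bigr => B /andP[Bg BV]; rewrite (interior_glue2 aj jb nc1 nc2) // !mark.
have -> : (a \in B) = false.
  by apply/negbTE/negP => /(nc_sub nc2 Bg); rewrite itvE; olia.
suff -> : (j \in B) = false by [].
by apply: contraNF BV => jB; rewrite (nc_eq nc2 Bg Vg jB jV).
Qed.

Lemma weight_sing (a : 'I_N) b d g : nc_part (itv a.+1 b) g ->
  weight d a ([set a] |: g) = c d.+1 * weight 0 a.+1 g.
Proof.
move=> ncg; have ag : [set a] \notin g.
  by apply/negP => /(nc_sub ncg)/(_ (set11 a)); rewrite itvE; olia.
have aB B : B \in g -> (a \in B) = false.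
  by move=> Bg; apply/negbTE/negP => /(nc_sub ncg Bg); rewrite itvE; olia.
rewrite /weight big_setU1 //= mark set11 cards1 add1n.
have -> : interior_block ([set a] |: g) [set a] = false.
  apply/negbTE/negP => /interiorP[D [i [k [+ _ iD _ /(_ a (set11 a))]]]].
  rewrite !inE => /predU1P[DE|Dg]; first by move: iD; rewrite DE inE => /eqP->; olia.
  by have := nc_sub ncg Dg iD; rewrite itvE; olia.
congr (_ * _); apply: eq_bigr => B Bg; rewrite if_same mark aB //.
suff -> : interior_block ([set a] |: g) B = interior_block g B by [].
have [x0 x0B] := nc_n0 ncg Bg.
apply/interiorP/interiorP => -[D [i [k [Dg DB iD kD lt]]]].
  move: Dg; rewrite !inE => /predU1P[DE|Dg]; last by exists D, i, k.
  move: iD kD; rewrite DE !inE => /eqP ia /eqP ka.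
  by have := lt x0 x0B; rewrite ia ka; olia.
by exists D, i, k; split=> //; rewrite inE Dg orbT.
Qed.

Lemma sing_part (a : 'I_N) b g : nc_part (itv a.+1 b) g -> (a < b)%N ->
  nc_part (itv a b) ([set a] |: g).
Proof.
move=> ncg ab; have Hg B x : B \in g -> x \in B -> (a < x < b)%N.
  by move=> Bg xB; have := nc_sub ncg Bg xB; rewrite itvE.
split.
- move=> B; rewrite !inE => /predU1P[->|/(nc_n0 ncg)//]; by exists a; rewrite inE.
- move=> B x; rewrite !inE => /predU1P[->|Bg]; first by rewrite inE => /eqP->; olia.
  by move=> /(Hg _ _ Bg); olia.
- move=> x; rewrite itvE => xab; have [->|xa] := eqVneq x a.
    by exists [set a]; rewrite !inE ?eqxx.
  have [|B Bg xB] := nc_cover ncg (x := x).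
    by move: xa; rewrite itvE -val_eqE /=; olia.
  by exists B => //; rewrite inE Bg orbT.
- move=> B D x; rewrite !inE => /predU1P[->|Bg] /predU1P[->|Dg] //.
  + by rewrite inE => /eqP-> /(Hg _ _ Dg); olia.
  + by rewrite inE => + /eqP xa; rewrite xa => /(Hg _ _ Bg); olia.
  + by move=> xB xD; apply: (nc_eq ncg Bg Dg xB xD).
- move=> B D x y z w; rewrite !inE => /predU1P[->|Bg] /predU1P[->|Dg] //.
  + by rewrite !inE => /eqP-> _ /eqP->; olia.
  + by rewrite !inE => _ /eqP-> _ /eqP->; olia.
  + by move=> xB yD zB wD; apply: (nc_cross ncg Bg Dg xB yD zB wD).
Qed.

Lemma rem_sing_part (a : 'I_N) b g : nc_part (itv a b) g -> (a < b)%N ->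
  pblock g a = [set a] -> nc_part (itv a.+1 b) (g :\ [set a]).
Proof.
move=> ncg ab ga; have aS : a \in itv a b by rewrite itvE leqnn.
have [] := blk_in ncg aS; rewrite ga => ag _.
split.
- by move=> B; rewrite !inE => /andP[_ /(nc_n0 ncg)].
- move=> B x; rewrite !inE => /andP[Ba Bg] xB; have := nc_sub ncg Bg xB.
  have : x != a.
    by apply: contraNneq Ba => xa; rewrite xa in xB; rewrite (nc_eq ncg Bg ag xB) ?inE.
  by rewrite itvE -val_eqE /=; olia.
- move=> x; rewrite itvE => xab; have [|B Bg xB] := nc_cover ncg (x := x).
    by rewrite itvE; olia.
  exists B => //; rewrite !inE Bg andbT; apply/eqP => BE.
  by move: xB xab; rewrite BE inE => /eqP->; olia.
- by move=> B D x; rewrite !inE => /andP[_ Bg] /andP[_ Dg] xB xD;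
    apply: (nc_eq ncg Bg Dg xB xD).
- by move=> B D x y z w; rewrite !inE => /andP[_ Bg] /andP[_ Dg] xB yD zB wD;
    apply: (nc_cross ncg Bg Dg xB yD zB wD).
Qed.

Definition wsum d a b := \sum_(g in NCp (itv a b)) weight d a g.
Definition free_sum a b := \sum_(g in NCp (itv a b)) free_weight g.

Lemma NCp0 : NCp set0 = [set set0].
Proof.
apply/setP => g; rewrite !inE partition_set0; have [->|//] := eqVneq.
by apply/forall_inP => B; rewrite inE.
Qed.

Lemma itv0 a : itv a a = set0.
Proof. by apply/setP => x; rewrite itvE inE; olia. Qed.

Lemma wsum0 d a : wsum d a a = 1.
Proof. by rewrite /wsum itv0 NCp0 big_set1 /weight big_set0. Qed.

(** Either [a] is alone in its block, which then has total size [d.+1], or [j] is the next element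
    of that block, and the partition is glued from one of the gap between [a] and [j] and one of the
    rest. *)
Lemma wsum_rec d (a : 'I_N) b : (a < b)%N ->
  wsum d a b = c d.+1 * wsum 0 a.+1 b +
    \sum_(j : 'I_N | (a < j < b)%N) free_sum a.+1 j * wsum d.+1 j b.
Proof.
move=> ab; have aS : a \in itv a b by rewrite itvE leqnn.
rewrite {1}/wsum (bigID (fun g => pblock g a == [set a])) /=; congr (_ + _).
  rewrite /wsum mulr_sumr.
  rewrite (reindex_onto (fun g => [set a] |: g) (fun g => g :\ [set a])) /=; last first.
    move=> g /andP[/NCpP ncg /eqP ga]; rewrite setD1K // -ga.
    by have [] := blk_in ncg aS.
  apply: eq_big => [g|g].
    apply/andP/idP => [[/andP[/NCpP ncg /eqP ga] /eqP<-]|/NCpP ncg].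
      exact/NCpP/rem_sing_part.
    have ncg' := sing_part ncg ab; split.
      apply/andP; split; first exact/NCpP.
      by apply/eqP/(blkE ncg'); rewrite !inE eqxx.
    rewrite setU1K //; apply/negP => /(nc_sub ncg)/(_ (set11 a)).
    by rewrite itvE; olia.
  move=> /andP[/andP[/NCpP ncg /eqP ga] /eqP gE]; apply: (weight_sing (b := b)).
  by rewrite -gE; apply: rem_sing_part.
(* The second element of the block of [a]; the default [a] is only reached when there is none. *)
pose nxt g := odflt a [pick j : 'I_N | (a < j < b)%N && linked a j g].
have lk (j k : 'I_N) g : (a < j)%N -> (a < k)%N -> linked a j g -> linked a k g -> j = k.
  move=> aj ak /linkedP[jV Hj] /linkedP[kV Hk]; apply: val_inj => /=.
  have [ja|kj] := Hk j jV; first by move: aj; rewrite ja ltnn.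
  have [ka|jk] := Hj k kV; first by move: ak; rewrite ka ltnn.
  by olia.
have nxtE g (j : 'I_N) : (a < j < b)%N -> linked a j g -> nxt g = j.
  move=> ajb lj; rewrite /nxt; case: pickP => [k /= /andP[/andP[ak _] lk']|/(_ j)].
    by apply: (lk _ _ _ ak) lk' lj; case/andP: ajb.
  by rewrite ajb lj.
have nxtP g : nc_part (itv a b) g -> pblock g a != [set a] ->
    (a < nxt g < b)%N && linked a (nxt g) g.
  move=> ncg ga; have [Vg aV] := blk_in ncg aS.
  rewrite /nxt; case: pickP => [//|no]; case/eqP: ga; apply/setP => x; rewrite inE.
  apply/idP/eqP => [xV|->//]; apply/eqP; case: (boolP (x == a)) => // xa.
  pose P k := (k \in pblock g a) && (k != a).
  have Px : P x by rewrite /P xV.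
  case: (arg_minnP (fun k : 'I_N => k : nat) Px) => j /andP[jV ja] jmin.
  have := no j; have := nc_sub ncg Vg jV; rewrite itvE => /andP[aj jb].
  have aj' : (a < j)%N by move: ja; rewrite -val_eqE /=; olia.
  rewrite aj' jb /= => /negP[]; apply/linkedP; split=> // k kV.
  by have [->|ka] := eqVneq k a; [left|right; apply: jmin; rewrite /P kV].
rewrite (partition_big nxt (fun j : 'I_N => (a < j < b)%N)) /=; last first.
  by move=> g /andP[/NCpP ncg ga]; case/andP: (nxtP g ncg ga).
apply: eq_bigr => j ajb; have /andP[aj jb] := ajb.
transitivity (\sum_(g in NCp (itv a b) | linked a j g) weight d a g).
  apply: eq_bigl => g; rewrite -andbA; case: (boolP (g \in _)) => //= /NCpP ncg.
  apply/andP/idP => [[ga /eqP<-]|lj]; first by case/andP: (nxtP g ncg ga).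
  rewrite (nxtE g j) //; split=> //; apply/eqP => ga.
  by case/linkedP: lj; rewrite ga inE -val_eqE /= => /eqP; olia.
rewrite sum_linked // mulr_suml; apply: eq_bigr => g1 /NCpP nc1.
by rewrite mulr_sumr; apply: eq_bigr => g2 /NCpP nc2; rewrite (weight_glue _ aj jb).
Qed.

End Weights.
End NonCrossingPartitions.

(** * Weighted sums over non-crossing partitions *)

Section WeightedSeries.
Variable T : comNzRingType.
Implicit Types c r : nat -> T.

(** When [c] and [r] agree, interior and exterior blocks weigh the same, so free moments are a
    special case. *)
Lemma free_sumE N r a b : @free_sum N T r a b = @wsum N T r r 0 a b.
Proof.
apply: eq_bigr => g _; rewrite /weight; apply: eq_bigr => B _.
by rewrite if_same addn0 if_same.
Qed.

Lemma sum_itv N (f : nat -> T) a n : (a + n.+1 <= N)%N ->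
  \sum_(j : 'I_N | (a < j < a + n.+1)%N) f j = \sum_(i < n) f (a.+1 + i)%N.
Proof.
move=> le; transitivity (\sum_(a.+1 <= j < a + n.+1) f j).
  by rewrite (big_nat_widen _ _ _ _ _ le) big_geq_mkord; apply: eq_bigl => j; rewrite andbC.
rewrite -{1}[a.+1]add0n big_addn.
have -> : (a + n.+1 - a.+1 = n)%N by lia.
rewrite big_mkord.
by apply: eq_bigr => i _; rewrite addnC.
Qed.

Lemma wsum_recD N c r d a n : (a + n.+1 <= N)%N ->
  @wsum N T c r d a (a + n.+1) = c d.+1 * @wsum N T c r 0 a.+1 (a.+1 + n) +
    \sum_(i < n) @wsum N T r r 0 a.+1 (a.+1 + i) *
                 @wsum N T c r d.+1 (a.+1 + i) (a.+1 + i + (n - i)).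
Proof.
move=> le; have aN : (a < N)%N by lia.
have ab : (Ordinal aN < a + n.+1)%N by rewrite /=; lia.
rewrite (wsum_rec c r d ab) /=; rewrite addSnnS; congr (_ + _).
rewrite (sum_itv (fun j => @free_sum N T r a.+1 j * @wsum N T c r d.+1 j (a + n.+1)) le).
apply: eq_bigr => i _; rewrite free_sumE.
by have -> : (a.+1 + i + (n - i) = a + n.+1)%N by have := ltn_ord i; lia.
Qed.

Definition wseq c r d n := @wsum n T c r d 0 n.

(** Both sides obey the recursion [wsum_recD], so translation invariance follows without
    transporting partitions between index types. *)
Lemma wsum_shift N c r d a n : (a + n <= N)%N -> @wsum N T c r d a (a + n) = wseq c r d n.
Proof.
elim/ltn_ind: n => -[|n] IH in N c r d a *; first by rewrite addn0 /wseq !wsum0.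
move=> le; rewrite /wseq -{3}[n.+1]add0n !wsum_recD //.
congr (_ * _ + _); first by rewrite !(IH n) //; lia.
apply: eq_bigr => i _; have := ltn_ord i => lt_in.
by congr (_ * _); [rewrite !(IH i)|rewrite !(IH (n - i)%N)] => //; lia.
Qed.

Lemma wseq0 c r d : wseq c r d 0 = 1.
Proof. exact: wsum0. Qed.

Lemma wseqS c r d n : wseq c r d n.+1 =
  c d.+1 * wseq c r 0 n + \sum_(i < n) wseq r r 0 i * wseq c r d.+1 (n - i).
Proof.
rewrite {1}/wseq -{2}[n.+1]add0n wsum_recD // wsum_shift //; congr (_ + _).
apply: eq_bigr => i _; have := ltn_ord i => lt_in.
by rewrite !wsum_shift //; lia.
Qed.

(** The constant term is dropped because in [wseqS] the interval starting at the second element of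
    the block is never empty. *)
Definition wser c r d : fps T := fun n => if n is _.+1 then wseq c r d n else 0.

Lemma wser0 c r : wseq c r 0 = 1 + wser c r 0 :> fps T.
Proof.
by apply/funext => -[|n]; rewrite fpsD fps_coef1 /= ?wseq0 (addr0, add0r).
Qed.

Lemma wserE c r d : wser c r d = fpsz T *
  (fps_const (c d.+1) * (wseq c r 0 : fps T) + (wseq r r 0 : fps T) * wser c r d.+1).
Proof.
apply/funext => -[|n]; rewrite fpszM //= wseqS fpsD fps_constM; congr (_ + _).
rewrite fpsM big_ord_recr /= subnn mulr0 addr0; apply: eq_bigr => i _.
by rewrite -(subnSK (ltn_ord i)).
Qed.
End WeightedSeries.

Lemma image_const (I : finType) (S : Type) (x : S) (B : {set I}) :
  [seq x | i in B] = nseq #|B| x.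
Proof. by rewrite /image_mem cardE; elim: (enum _) => //= y s ->. Qed.

(** With all arguments equal to [W], a cumulant depends only on the size of its block. *)
Lemma moment_wseq (K : fieldType) (A : algType K) (phi psi : {scalar A}) (W : A) n :
  phi 1 = 1 ->
  phi (W ^+ n) = wseq (fun k => cfree_cumulant phi psi (nseq k W))
                      (fun k => free_cumulant psi (nseq k W)) 0 n.
Proof.
case: n => [|n] phi1; first by rewrite wseq0.
have := cfree_cumulantP phi psi (fun _ : 'I_n.+1 => W).
rewrite prodr_const card_ord => ->; rewrite /wseq /wsum.
have -> : itv n.+1 0 n.+1 = setT by apply/setP => x; rewrite itvE inE ltn_ord.
apply: eq_big => [g|g _]; first by rewrite inE.
rewrite [RHS](bigID (interior_block g)) /= mulrC.
congr (_ * _); apply: eq_bigr => B /andP[_ iB]; rewrite ?iB ?(negbTE iB) image_const //.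
by rewrite if_same addn0.
Qed.

Lemma free_moment_wseq (K : fieldType) (A : algType K) (psi : {scalar A}) (W : A) n :
  psi 1 = 1 ->
  psi (W ^+ n) = wseq (fun k => free_cumulant psi (nseq k W))
                      (fun k => free_cumulant psi (nseq k W)) 0 n.
Proof.
case: n => [|n] psi1; first by rewrite wseq0.
have := free_cumulantP psi (fun _ : 'I_n.+1 => W).
rewrite prodr_const card_ord => ->; rewrite /wseq -free_sumE /free_sum.
have -> : itv n.+1 0 n.+1 = setT by apply/setP => x; rewrite itvE inE ltn_ord.
apply: eq_big => [g|g _]; first by rewrite inE.
by apply: eq_bigr => B _; rewrite image_const.
Qed.

(** * Moments and cumulants of one element *)

Section SingleVariable.
Variable K : fieldType.

Lemma fps_comp_const (a : K) s : s 0%N = 0 -> fps_comp (fps_const a) s = fps_const a.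
Proof.
move=> s0; apply/funext => n; rewrite (fps_compE _ s0 (ltnSn n)) big_ord_recl.
rewrite big1 => [|i _]; last exact: mul0r.
by case: n => [|n]; rewrite addr0 ?mulr0 ?mulr1.
Qed.

Lemma fps_exp_mulE (P Q : fps K) k n : P 0%N = 0 -> (n < k)%N -> (P ^+ k * Q) n = 0.
Proof.
by move=> /fps_divXK[t ->] lt_nk; rewrite exprMn -mulrA fps_zX leqNgt lt_nk.
Qed.

(** Composing [wserE] with [s] and iterating in [d] produces the powers of [s * H] one by one, with
    a remainder of ever higher order. *)
Lemma wseq_comp (c r : nat -> K) (s : fps K) (h := fps_comp (wseq c r 0) s)
    (H := fps_comp (wseq r r 0) s) : s 0%N = 0 ->
  h - 1 = h * s * fps_comp (fun k => c k.+1) (s * H).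
Proof.
move=> s0; pose x d := fps_comp (wser c r d) s.
have xE d : x d = s * (fps_const (c d.+1) * h + H * x d.+1).
  by rewrite /x {1}wserE fps_compM // fps_compD // !fps_compM // fps_comp_const // fps_comp_z.
pose G : fps K := s * H; pose E m := \sum_(k < m) fps_const (c k.+1) * G ^+ k.
(* The remainder carries the factor [G ^+ m], which vanishes in degrees below m. *)
have hE m : h - 1 = h * s * E m + G ^+ m * x m.
  elim: m => [|m ->]; rewrite /E.
    by rewrite big_ord0 mulr0 add0r mul1r /h wser0 fps_compD // fps_comp1 // addrC addKr.
  by rewrite big_ord_recr /= xE exprS /G; ring.
have G0 : G 0%N = 0 by rewrite /G fpsM big_ord1 s0 mul0r.
apply/funext => n; rewrite (hE n.+1) fpsD fps_exp_mulE // addr0 !fpsM.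
apply: eq_bigr => i _; congr (_ * _).
rewrite (fps_compE _ G0 (m := n.+1)) ?ltnS ?leq_subr // /E fps_sum.
by apply: eq_bigr => k _; rewrite fps_constM.
Qed.

Variables (A : algType K) (phi psi : {scalar A}).
Hypotheses (phi1 : phi 1 = 1) (psi1 : psi 1 = 1).

Definition moment_series (f : {scalar A}) (W : A) : fps K := fun k => f (W ^+ k).

Variables (W : A) (s : fps K).
Hypotheses (s0 : s 0%N = 0).
Hypothesis (sP : fps_comp (moment_series psi W) s = 1 + fpsz K).

Lemma R_series1 : R_series psi W 1%N = psi W.
Proof.
by rewrite -[in RHS](expr1 W) free_moment_wseq // wseqS big_ord0 wseq0 mulr1 addr0.
Qed.

(** In [wseq_comp] with both weights equal to the free cumulants, [h] is 1 + z, and the identity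
    reads z = R(s (1 + z)). *)
Lemma R_series_inv : psi W != 0 -> fps_comp_inv (R_series psi W) = s * (1 + fpsz K).
Proof.
move=> W0; set F := R_series psi W; set G := s * _.
have G0 : G 0%N = 0 by rewrite /G fpsM big_ord1 s0 mul0r.
have momE : moment_series psi W = wseq (fun k => free_cumulant psi (nseq k W))
    (fun k => free_cumulant psi (nseq k W)) 0.
  by apply/funext => k; apply: free_moment_wseq.
have := wseq_comp (fun k => free_cumulant psi (nseq k W))
  (fun k => free_cumulant psi (nseq k W)) s0.
rewrite -momE sP [1 + _ - 1]addrAC subrr add0r [_ * s]mulrC -/G => zE.
have FG : fps_comp F G = fpsX K.
  have -> : F = fpsz K * fps_divX F by apply/funext => -[|n]; rewrite fpszM.
  by rewrite fps_compM // fps_comp_z // [RHS]zE.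
have [H0 FH HF] : is_fps_comp_inv F (fps_comp_inv F).
  by apply: fps_comp_invP; rewrite /F ?R_series1.
by rewrite -[LHS]fps_compX -FG -fps_compA // HF fps_compXl.
Qed.

Lemma cR_series_comp (h := fps_comp (moment_series phi W) s) : psi W != 0 ->
  h - 1 = h * s * fps_comp (fps_divX (cR_series phi psi W)) (fps_comp_inv (R_series psi W)).
Proof.
move=> W0; rewrite R_series_inv // -sP.
have -> : moment_series psi W = wseq (fun k => free_cumulant psi (nseq k W))
    (fun k => free_cumulant psi (nseq k W)) 0.
  by apply/funext => k; apply: free_moment_wseq.
have hE : moment_series phi W = wseq (fun k => cfree_cumulant phi psi (nseq k W))
    (fun k => free_cumulant psi (nseq k W)) 0.
  by apply/funext => k; apply: moment_wseq.
by rewrite /h hE; apply: wseq_comp.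
Qed.
End SingleVariable.

(** * Generated subalgebras and alternating words of series *)

Section CFreeSeries.
Variables (K : fieldType) (A : algType K).
Implicit Types (phi psi : {scalar A}) (X Y : A).

Lemma gen_subalg_lin X k u v :
  gen_subalg X u -> gen_subalg X v -> gen_subalg X (k *: u + v).
Proof.
by move=> Xu Xv S clS XS; have [_ linS _] := clS; apply: linS; [apply: Xu|apply: Xv].
Qed.

Lemma gen_subalg1 X : gen_subalg X 1.
Proof. by move=> S []. Qed.

Lemma gen_subalgM X u v : gen_subalg X u -> gen_subalg X v -> gen_subalg X (u * v).
Proof.
by move=> Xu Xv S clS XS; have [_ _ mS] := clS; apply: mS; [apply: Xu|apply: Xv].
Qed.

Lemma gen_subalgX X n : gen_subalg X (X ^+ n).
Proof.
elim: n => [|n IH]; first exact: gen_subalg1.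
by rewrite exprS; apply: gen_subalgM => // S.
Qed.

Lemma gen_subalgB X u v : gen_subalg X u -> gen_subalg X v -> gen_subalg X (u - v).
Proof.
by move=> Xu Xv; rewrite addrC -scaleN1r; apply: gen_subalg_lin.
Qed.

Lemma gen_subalg0 X : gen_subalg X 0.
Proof.
by rewrite -(subrr (1 : A)); exact: (gen_subalgB (@gen_subalg1 X) (@gen_subalg1 X)).
Qed.

Lemma gen_subalg_nat X n : gen_subalg X n%:R.
Proof.
elim: n => [|n IH]; first exact: gen_subalg0.
by rewrite mulrS -[X in X + _]scale1r; exact: (gen_subalg_lin _ (@gen_subalg1 X) IH).
Qed.

Lemma gen_subalg_resolvent X s n : gen_subalg X (fps_resolvent s X n).
Proof.
apply: (big_ind (gen_subalg X)) => [|u v Xu Xv|k _]; first exact: gen_subalg0.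
  by rewrite -[u]scale1r; apply: gen_subalg_lin.
by rewrite -[_ *: _]addr0; exact: (gen_subalg_lin _ (gen_subalgX k) (@gen_subalg0 X)).
Qed.

(** Stated for any semiring, as both the words in A[[z]] and the products of their images in K[[z]]
    have this form. *)
Fixpoint altprod (T : pzSemiRingType) (f : bool -> T) b n : T :=
  if n is m.+1 then f b * altprod f (~~ b) m else 1.

Lemma altprod_double (T : pzSemiRingType) (f : bool -> T) b n :
  altprod f b n.*2 = (f b * f (~~ b)) ^+ n.
Proof. by elim: n => //= n IH; rewrite negbK IH exprS mulrA. Qed.

Lemma altprod_doubleS (T : pzSemiRingType) (f : bool -> T) b n :
  altprod f b n.*2.+1 = (f b * f (~~ b)) ^+ n * f b.
Proof.
elim: n => [|n IH]; first by rewrite /= mulr1 mul1r.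
by rewrite doubleS [LHS]/= negbK -[f b * altprod _ _ _]/(altprod f b n.*2.+1) IH exprS !mulrA.
Qed.

Section Words.
Variables (phi psi : {scalar A}) (X Y : A).
Hypotheses (phi1 : phi 1 = 1) (hXY : cfree phi psi X Y).

Lemma cfree_seq b (p : seq A) :
  (forall i, (i < size p)%N ->
     gen_subalg (if b (+) odd i then Y else X) p`_i /\ psi p`_i = 0) ->
  phi (\prod_(x <- p) x) = \prod_(x <- p) phi x.
Proof.
(* [cfree] only speaks of nonempty words; the empty one is [phi 1 = 1]. *)
case E: (size p) => [|n] H; first by rewrite (size0nil E) !big_nil.
rewrite (congr1 phi (big_nth 0 _ _)) [RHS](big_nth 0) E !big_mkord.
have [i|i j ij|i|_ ->//] := @hXY n (fun i => b (+) odd i) (fun i => p`_i).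
- by have [] := H i (ltn_ord i).
- by rewrite ij /= addbN; case: (b (+) odd i).
- by have [] := H i (ltn_ord i).
Qed.

Variable f : bool -> fps A.
Hypothesis fP : forall b n, gen_subalg (if b then Y else X) (f b n) /\ psi (f b n) = 0.

(* The induction absorbs the leading series of the word one coefficient at a
   time into a list [p] of elements of [A]. *)
Lemma cfree_altprod b n :
  fps_map phi (altprod f b n) = altprod (fun b => fps_map phi (f b)) b n.
Proof.
suff E p : (forall i, (i < size p)%N ->
      gen_subalg (if b (+) odd i then Y else X) p`_i /\ psi p`_i = 0) ->
    fps_map phi (fps_const (\prod_(x <- p) x) * altprod f (b (+) odd (size p)) n) =
    fps_const (\prod_(x <- p) phi x) *
      altprod (fun b => fps_map phi (f b)) (b (+) odd (size p)) n.
  have := E [::] (fun i => ltac:(by [])); rewrite !big_nil /= addbF.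
  have -> : fps_const (1 : A) = 1 by apply/funext => -[].
  have -> : fps_const (1 : K) = 1 by apply/funext => -[].
  by rewrite !mul1r.
elim: n p => [|n IH] p Hp.
  rewrite !mulr1; apply/funext => -[|k]; rewrite /fps_map /=; last exact: linear0.
  exact: cfree_seq Hp.
apply/funext => k; rewrite fps_constM /fps_map fps_constM /= fpsM mulr_sumr linear_sum.
rewrite fpsM mulr_sumr; apply: eq_bigr => i _.
have Hq j : (j < size (rcons p (f (b (+) odd (size p)) i)))%N ->
    gen_subalg (if b (+) odd j then Y else X) (rcons p (f (b (+) odd (size p)) i))`_j /\
    psi (rcons p (f (b (+) odd (size p)) i))`_j = 0.
  rewrite size_rcons ltnS nth_rcons leq_eqVlt => /predU1P[->|lt]; last by rewrite lt; apply: Hp.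
  by rewrite ltnn eqxx; apply: fP.
have := congr1 (@^~ (k - i)%N) (IH _ Hq).
rewrite /fps_map /= !fps_constM !big_rcons /= size_rcons /= addbN => IH'.
by rewrite !mulrA.
Qed.
End Words.
End CFreeSeries.

(** * The resolvent of a product *)

(** With u = 1 + a and v = 1 + b, the left side is 1 + z u + z v - z u v; [a] and [b] need not
    commute. *)
Lemma factor_identity (T : nzRingType) (z a b : T) :
  z * a = a * z ->
  (1 + z + z * a) * (1 + z + z * b) - z * (1 + z) * ((1 + a) * (1 + b)) =
  1 + z - z * (a * b).
Proof.
move=> za; have -> : 1 + z + z * a = 1 + z * (1 + a) by rewrite mulrDr mulr1 addrA.
have -> : 1 + z + z * b = 1 + z * (1 + b) by rewrite mulrDr mulr1 addrA.
have H u v : z * u = u * z ->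
    (1 + z * u) * (1 + z * v) - z * (1 + z) * (u * v) =
    1 + z * v + z * u - z * (u * v).
  move=> zu; have -> : (1 + z * u) * (1 + z * v) = 1 + z * v + z * u + z * z * (u * v).
    rewrite mulrDl mul1r mulrDr mulr1 addrA; congr (_ + _).
    by rewrite -(mulrA z u) (mulrA u z v) -zu !mulrA.
  have -> : z * (1 + z) * (u * v) = z * (u * v) + z * z * (u * v).
    by rewrite mulrDr mulr1 mulrDl.
  by rewrite [z * (u * v) + _]addrC addrKA.
rewrite {}H; last by rewrite mulrDr mulrDl mulr1 mul1r za.
apply: (addIr (z * ((1 + a) * (1 + b)))); rewrite subrK.
have -> : (1 + a) * (1 + b) = (1 + b) + (a + a * b).
  by rewrite mulrDl mul1r [a * _]mulrDr mulr1.
rewrite (mulrDr z (1 + b)) (mulrDr z a) [z * a + _]addrC.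
rewrite [RHS]addrCA (addrA (1 + z - _)) subrK (mulrDr z 1 a) mulr1.
by rewrite -[1 + z + _]addrA [RHS]addrCA addrA.
Qed.

Lemma mul_central (T : pzSemiRingType) (c d e u v x y : T) :
  (forall w, c * w = w * c) -> (forall w, d * w = w * d) ->
  (forall w, e * w = w * e) -> x * u = u * x ->
  u * (c * d * e * (x * y)) * v = c * ((d * x * u) * (e * y * v)).
Proof.
move=> cC dC eC xu; rewrite -!mulrA (mulrA u c) -cC -mulrA; congr (_ * _).
rewrite (mulrA u d) -dC -mulrA; congr (_ * _).
rewrite !(mulrA u e) -(eC u) -!mulrA (mulrA x e) -(eC x) -!mulrA.
by rewrite (mulrA u x) -xu -mulrA.
Qed.

Section Product.
Variables (K : fieldType) (A : algType K) (phi psi : {scalar A}) (X Y : A).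
Hypotheses (phi1 : phi 1 = 1) (psi1 : psi 1 = 1) (hXY : cfree phi psi X Y).

Let z := fpsz K.

(** The series (U - 1 - z) / z for the resolvent U, called a or b in the overview; [locked] keeps it
    from unfolding under simplification. *)
Definition centered_part (W : A) (s : fps K) : fps A :=
  locked (fun n => fps_resolvent s W n.+1 - (n == 0)%:R).

Lemma centered_partE W s n :
  centered_part W s n = fps_resolvent s W n.+1 - (n == 0)%:R.
Proof. by rewrite /centered_part -lock. Qed.

Lemma resolvent_centered W s : s 0%N = 0 ->
  fps_resolvent s W = 1 + fpsz A + fpsz A * centered_part W s.
Proof.
move=> s0; apply/funext => -[|n]; rewrite !fpsD fpszM fps_coef1 /=.
  by rewrite !addr0 /fps_resolvent big_ord1 !expr0 fps_coef1 scale1r.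
by rewrite add0r centered_partE addrC subrK.
Qed.

Lemma centered_part0 W s n : s 0%N = 0 ->
  fps_comp (moment_series psi W) s = 1 + fpsz K -> psi (centered_part W s n) = 0.
Proof.
move=> s0 sP; rewrite centered_partE linearB raddfMn /= psi1.
have := congr1 (@^~ n.+1) (fps_map_resolvent psi W s0).
rewrite /fps_map => ->; rewrite -/(moment_series psi W) sP fpsD fps_coef1 add0r.
by rewrite /fpsz eqSS subrr.
Qed.

Lemma gen_subalg_centered_part W s n : gen_subalg W (centered_part W s n).
Proof.
rewrite centered_partE.
exact: (gen_subalgB (@gen_subalg_resolvent _ _ W s n.+1) (@gen_subalg_nat _ _ W _)).
Qed.

(** Multiplied by z, the left side is s W U = U - 1 = z (1 + a), and z can be cancelled. *)
Lemma resolvent_mul_centered W s1 (s := z * s1) :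
  fps_scal A s1 * fps_const W * fps_resolvent s W = 1 + centered_part W s.
Proof.
have s0 : s 0%N = 0 by rewrite /s fpszM.
apply: (@fpsz_lreg A).
have /eqP := fps_resolventP W s0; rewrite mulrBl mul1r subr_eq => /eqP E.
rewrite !mulrA -(fps_scal_z A) -fps_scalM -/s.
have := resolvent_centered W s0; rewrite {1}E -addrA => /addrI->.
by rewrite fps_scal_z mulrDr mulr1.
Qed.

Lemma fps_map_centered W s : phi 1 = 1 -> s 0%N = 0 ->
  fps_comp (moment_series phi W) s =
  1 + z + z * fps_map phi (centered_part W s).
Proof.
move=> f1 s0; rewrite -(fps_map_resolvent phi W s0) (resolvent_centered W s0).
rewrite !fps_mapD fps_map1 // -(fps_scal_z A) fps_map_scal; congr (_ + _ + _).
by rewrite -[fps_scal _ _]mulr1 fps_map_scal fps_map1 // mulr1.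
Qed.

(** Applied with c = 1 + z, d = z and [M] a power of a b, between V and U. *)
Lemma fps_map_sandwich (c d : fps K) (P M Q : fps A) :
  fps_map phi ((fps_scal A c + fps_scal A d * P) * M * (fps_scal A c + fps_scal A d * Q)) =
  c * c * fps_map phi M + c * d * (fps_map phi (P * M) + fps_map phi (M * Q)) +
  d * d * fps_map phi (P * M * Q).
Proof.
rewrite mulrDl -(mulrA _ P) mulrDr -(fps_scalC c) (mulrA _ (fps_scal A d) Q).
rewrite -(fps_scalC d) -!mulrA (mulrDl _ _ Q) !(fps_mapD, fps_map_scal) -!mulrA.
by rewrite !fps_map_scal; ring.
Qed.

Section Factorization.
Variables s1 t1 : fps K.
Let s := z * s1.
Let t := z * t1.
Hypothesis sP : fps_comp (moment_series psi X) s = 1 + z.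
Hypothesis tP : fps_comp (moment_series psi Y) t = 1 + z.

(** Thus [z * rho1] is the series s t (1 + z) / z, written without a division. *)
Let rho1 := s1 * t1 * (1 + z).
Let U := fps_resolvent s X.
Let V := fps_resolvent t Y.
Let a := centered_part X s.
Let b := centered_part Y t.
Let s0 : s 0%N = 0. Proof. by rewrite /s fpszM. Qed.
Let t0 : t 0%N = 0. Proof. by rewrite /t fpszM. Qed.

(** By [resolvent_mul_centered], U rho X Y V is z (1 + z) (1 + a) (1 + b), and [factor_identity]
    applies. *)
Lemma resolvent_factor :
  U * (1 - fps_scal A (z * rho1) * fps_const (X * Y)) * V =
  1 + fpsz A - fpsz A * (a * b).
Proof.
rewrite -(factor_identity b (fpsz_comm a)).
rewrite -(resolvent_centered X s0) -(resolvent_centered Y t0) -/U -/V.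
rewrite mulrBr mulr1 mulrBl; congr (_ - _).
rewrite -(resolvent_mul_centered X s1) -(resolvent_mul_centered Y t1) -/s -/t -/U -/V.
have -> : z * rho1 = z * (1 + z) * s1 * t1 by rewrite /rho1; ring.
rewrite !fps_scalM fps_scalD fps_scal1 fps_scal_z fps_const_mul.
apply: mul_central => [P|P|P|]; rewrite ?fps_scalC //; last exact: fps_resolvent_comm.
by rewrite -(fps_scal_z A) -fps_scal1 -fps_scalD -fps_scalM fps_scalC.
Qed.

Lemma resolvent_mul : exists2 Q, (1 + fpsz A - fpsz A * (a * b)) * Q = 1 &
  fps_resolvent (z * rho1) (X * Y) = V * Q * U.
Proof.
have [Q QP] := fps_1Bz_inv (a * b - 1).
have E : 1 + fpsz A - fpsz A * (a * b) = 1 - fpsz A * (a * b - 1).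
  by rewrite mulrBr mulr1 opprB addrA addrAC.
exists Q; first by rewrite E.
have r0 : (z * rho1) 0%N = 0 by rewrite fpszM.
apply: (@fps_1Bz_lreg _ (fps_scal A rho1 * fps_const (X * Y))).
have -> : fpsz A * (fps_scal A rho1 * fps_const (X * Y)) =
    fps_scal A (z * rho1) * fps_const (X * Y).
  by rewrite fps_scalM fps_scal_z mulrA.
rewrite (fps_resolventP _ r0); set D := 1 - _.
(* It remains to see D V Q U = 1; this follows from U D V Q = 1 by cancelling U, whose left inverse
   is 1 - s X. *)
have UD : U * (D * (V * Q * U)) = U.
  by rewrite !mulrA resolvent_factor E QP mul1r.
have LU := fps_resolventP X s0.
by rewrite -[RHS]mul1r -[X in _ = X * _]LU -[RHS]mulrA UD LU.
Qed.

Let al := fps_map phi a.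
Let be := fps_map phi b.

Let f (c : bool) := if c then b else a.
Let fP c n : gen_subalg (if c then Y else X) (f c n) /\ psi (f c n) = 0.
Proof.
case: c; split; rewrite ?centered_part0 //; exact: gen_subalg_centered_part.
Qed.
Let alt := cfree_altprod phi1 hXY fP.

(** Expanding V = 1 + z + z b and U = 1 + z + z a leaves four alternating words, on each of which
    [phi] is multiplicative. *)
Lemma cfree_words n : fps_map phi (V * (a * b) ^+ n * U) =
  (al * be) ^+ n * ((1 + z + z * al) * (1 + z + z * be)).
Proof.
(* The words (ab)^n, (ab)^n a, b (ab)^n and b (ab)^n a. *)
have w0 := alt false n.*2; have w1 := alt false n.*2.+1.
have w2 := alt true n.*2.+1; have w3 := alt true n.*2.+2.
rewrite altprod_double [RHS]altprod_double /= in w0.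
rewrite altprod_doubleS [RHS]altprod_doubleS /= in w1.
rewrite -[altprod f true _]/(f true * altprod f false n.*2) in w2.
rewrite -[altprod _ true _]/(be * altprod _ false n.*2) in w2.
rewrite !altprod_double /= in w2.
rewrite -[altprod f true _]/(f true * altprod f false n.*2.+1) in w3.
rewrite -[altprod _ true _]/(be * altprod _ false n.*2.+1) in w3.
rewrite !altprod_doubleS /= in w3.
rewrite /U /V (resolvent_centered X s0) (resolvent_centered Y t0) -/a -/b.
rewrite -(fps_scal_z A) -fps_scal1 -fps_scalD fps_map_sandwich.
rewrite -(mulrA b) w0 w1 w2 w3 -/al -/be -/z; move: ((al * be) ^+ n) => w; ring.
Qed.

(** Formally, Q is the sum of z^n (ab)^n / (1 + z)^(n+1), to which [cfree_words] applies termwise.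
    The recursion for [J] replaces the infinite sum, and [D n] is the deviation of [J n] from the
    expected value. *)
Lemma cfree_resolvent :
  fps_comp (moment_series phi (X * Y)) (z * rho1) * (1 + z - z * (al * be)) =
  (1 + z + z * al) * (1 + z + z * be).
Proof.
have [Q QP E] := resolvent_mul.
have r0 : (z * rho1) 0%N = 0 by rewrite fpszM.
rewrite -(fps_map_resolvent phi _ r0) E {E}.
(* [e] is the inverse of 1 + z. *)
have [e eP] := fps_1Bz_inv (-1 : fps K); rewrite mulrN1 opprK in eP.
set hh := _ * (1 + z + z * be).
pose J n := fps_map phi (V * (a * b) ^+ n * (Q * U)).
pose D n := J n * (1 + z - z * (al * be)) - (al * be) ^+ n * hh.
have JE n : (1 + z) * J n = (al * be) ^+ n * hh + z * J n.+1.
  rewrite /hh -cfree_words -!fps_map_scal -fps_mapD; congr fps_map.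
  rewrite fps_scalD fps_scal1 fps_scal_z.
  have QE : (1 + fpsz A) * Q = 1 + fpsz A * (a * b * Q).
    by apply/eqP; rewrite -subr_eq (mulrA _ (a * b)) -mulrBl QP.
  have zC P : fpsz A * P = P * fpsz A by apply: fpsz_comm.
  have cC P : (1 + fpsz A) * P = P * (1 + fpsz A) by rewrite mulrDl mulrDr mul1r mulr1 zC.
  rewrite mulrA cC -mulrA (mulrA (1 + _)) QE mulrDl mul1r mulrDr; congr (_ + _).
  rewrite -(mulrA (fpsz A)) (mulrA (V * _)) -zC -mulrA; congr (_ * _).
  by rewrite exprSr !mulrA.
have DE n : D n = z * (e * D n.+1).
  apply: (@fps_mulfI _ (1 + z)).
    by apply/eqP => /(congr1 (@^~ 0%N))/eqP; rewrite fpsD /= addr0 oner_eq0.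
  have -> : (1 + z) * (z * (e * D n.+1)) = (1 + z) * e * (z * D n.+1) by ring.
  rewrite eP mul1r /D exprS; move: (JE n); move: (J n) (J n.+1) ((al * be) ^+ n) => j j' w jE.
  transitivity ((1 + z) * j * (1 + z - z * (al * be)) - (1 + z) * (w * hh)); first by ring.
  by rewrite jE; ring.
suff : D 0%N = 0.
  by move/subr0_eq; rewrite /J expr0 mul1r mulr1 -!mulrA.
apply: fps_eq0 => k; suff [G ->] : exists G, D 0%N = z ^+ k * (G * D k).
  by exists (G * D k).
(* Each use of [DE] extracts a further factor z, so [D 0] is divisible by all powers of z. *)
elim: k => [|k [G ->]]; first by exists 1; rewrite !mul1r.
by exists (G * e); rewrite DE exprS; ring.
Qed.
End Factorization.
End Product.

(** * Elimination of the moment series *)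

Section Multiplicativity.
Variables (K : fieldType) (A : algType K) (phi psi : {scalar A}).
Hypotheses (phi1 : phi 1 = 1) (psi1 : psi 1 = 1).

Let z := fpsz K.

(** The moment series minus 1 has linear coefficient [psi W], so it has a compositional inverse. *)
Lemma moment_inverse W : psi W != 0 ->
  exists s1, fps_comp (moment_series psi W) (z * s1) = 1 + z.
Proof.
move=> W0; pose M : fps K := fun n => if n is _.+1 then psi (W ^+ n) else 0.
have [s0 Ms _] : is_fps_comp_inv M (fps_comp_inv M).
  by apply: fps_comp_invP => //=; rewrite expr1.
have [s1 sE] := fps_divXK s0; exists s1; rewrite -/z in sE; rewrite -sE.
have -> : moment_series psi W = 1 + M.
  by apply/funext => -[|n]; rewrite fpsD fps_coef1 /= ?psi1 ?addr0 ?add0r.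
by rewrite fps_compD // fps_comp1 // Ms.
Qed.

(** Comparison of linear coefficients; for [X * Y] it shows that both [psi (X * Y)] and rho are
    nonzero. *)
Lemma moment_inverse1 W s : s 0%N = 0 ->
  fps_comp (moment_series psi W) s = 1 + z -> psi W * s 1%N = 1.
Proof.
move=> s0 /(congr1 (@^~ 1%N)); rewrite (fps_compE _ s0 (ltnSn 1)) fpsD.
by rewrite !big_ord_recl big_ord0 /= expr0 !fps_coef1 mulr0 !add0r addr0 !expr1.
Qed.

(** Freeness for [psi] is c-freeness with both functionals equal to [psi]: the product of the
    vanishing [psi (a i)] is 0. *)
Lemma cfree_free X Y : cfree phi psi X Y -> cfree psi psi X Y.
Proof.
move=> hXY n e a ga ea pa; have [p0 _] := hXY n e a ga ea pa; split=> //.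
by rewrite p0 big_ord_recl pa mul0r.
Qed.

(** [cfree_resolvent] with [psi] in place of [phi]: the centered parts have image 0, and one factor
    1 + z cancels. *)
Lemma free_resolvent X Y s1 t1 : cfree phi psi X Y ->
  fps_comp (moment_series psi X) (z * s1) = 1 + z ->
  fps_comp (moment_series psi Y) (z * t1) = 1 + z ->
  fps_comp (moment_series psi (X * Y)) (z * (s1 * t1 * (1 + z))) = 1 + z.
Proof.
move=> hXY sP tP; have fXY := cfree_free hXY.
have c0 W u1 : fps_comp (moment_series psi W) (z * u1) = 1 + z ->
    fps_map psi (centered_part W (z * u1)) = 0.
  by move=> uP; apply/funext => n; apply: centered_part0 => //; rewrite fpszM.
have := cfree_resolvent psi1 psi1 fXY sP tP; rewrite !c0 // !mulr0 subr0 addr0.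
rewrite mulrC; apply: fps_mulfI.
by apply/eqP => /(congr1 (@^~ 0%N))/eqP; rewrite fpsD /= addr0 oner_eq0.
Qed.

Definition T_series W : fps K :=
  fps_comp (fps_divX (cR_series phi psi W)) (fps_comp_inv (R_series psi W)).

(** With D = 1 + z - z al be, everything rests on z D (h_XY - 1) = (1 + z) (h_X - 1) (h_Y - 1), a
    consequence of h_XY D = h_X h_Y; each h - 1 is then replaced by h times its series times T. *)
Lemma T_series_mul X Y : cfree phi psi X Y -> psi X != 0 -> psi Y != 0 ->
  T_series (X * Y) = T_series X * T_series Y.
Proof.
move=> hXY X0 Y0; have [s1 sP] := moment_inverse X0; have [t1 tP] := moment_inverse Y0.
have rP := free_resolvent hXY sP tP.
have z0 (u : fps K) : (z * u) 0%N = 0 by rewrite fpszM.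
have XY0 : psi (X * Y) != 0.
  apply/eqP => XY0; have := moment_inverse1 (z0 _) rP.
  by rewrite XY0 mul0r => /eqP; rewrite eq_sym oner_eq0.
have := cR_series_comp phi1 psi1 (z0 _) sP X0.
have := cR_series_comp phi1 psi1 (z0 _) tP Y0.
have := cR_series_comp phi1 psi1 (z0 _) rP XY0.
have := cfree_resolvent phi1 psi1 hXY sP tP.
rewrite (fps_map_centered (phi := phi) X phi1 (z0 s1)) (fps_map_centered (phi := phi) Y phi1 (z0 t1)).
rewrite -!/(T_series _) -/z.
move: (fps_map phi _) (fps_map phi _) (fps_comp _ _) => be al hP hD eP eY eX.
have h0 al' : 1 + z + z * al' != 0.
  apply/eqP => /(congr1 (@^~ 0%N))/eqP.
  by rewrite !fpsD fpszM /= !addr0 oner_eq0.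
have r0 : z * (s1 * t1 * (1 + z)) != 0.
  apply/eqP => r0; have := moment_inverse1 (z0 _) rP.
  by rewrite r0 mulr0 => /eqP; rewrite eq_sym oner_eq0.
(* The nonzero factors h_X h_Y rho and then z are put on both sides, where [hD] turns h_X h_Y into
   h_XY D. *)
apply: (fps_mulfI (fps_mul_neq0 (fps_mul_neq0 (h0 al) (h0 be)) r0)).
apply: (@fpsz_lreg K); rewrite -/z -{1}hD.
move: (T_series (X * Y)) (T_series X) (T_series Y) eP eX eY => TP TX TY eP eX eY.
transitivity (z * ((1 + z - z * (al * be)) * (hP * (z * (s1 * t1 * (1 + z))) * TP))); first by ring.
rewrite -eP.
transitivity ((1 + z) * (((1 + z + z * al) * (z * s1) * TX) * ((1 + z + z * be) * (z * t1) * TY))); last by ring.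
rewrite -eX -eY.
transitivity (z * (hP * (1 + z - z * (al * be)) - (1 + z - z * (al * be)))); first by ring.
by rewrite hD; ring.
Qed.
End Multiplicativity.

Theorem theorem3p6 (R : realType) (A : algType R[i]) (phi psi : {scalar A})
    (X Y : A) (hphi : phi 1 = 1) (hpsi : psi 1 = 1)
    (hXY : cfree phi psi X Y) (hX : psi X != 0) (hY : psi Y != 0) :
  fps_comp (fps_divX (cR_series phi psi (X * Y)))
           (fps_comp_inv (R_series psi (X * Y))) =
  fps_mul (fps_comp (fps_divX (cR_series phi psi X))
                    (fps_comp_inv (R_series psi X)))
          (fps_comp (fps_divX (cR_series phi psi Y))
                    (fps_comp_inv (R_series psi Y))).
Proof. exact: T_series_mul. Qed.
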